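(* Let $1\le k\le n$ and $0\le r\le n+1$ be integers. Then $$\left(\{M\in\mathrm{NCM}^{(r)}(n):\mathrm{even}(M)=k\},\ \langle\mathrm{rot}_n\rangle,\ \mathbf{Nar}(n,k+1;q)\begin{bmatrix} n+1\\ r\end{bmatrix}_q\right)$$ exhibits the cyclic sieving phenomenon, where $\langle\mathrm{rot}_n\rangle$ is regarded as an action of the cyclic group of order $n$.
   Context: Cyclic sieving: let $X$ be a finite set, $C_N$ a cyclic group of order $N$ with generator $g$ acting on $X$, and $f(q)$ a polynomial with non-negative integer coefficients. The triple $(X,C_N,f(q))$ exhibits the cyclic sieving phenomenon if for all $d\in\mathbb Z$, $|\{x\in X: g^d\cdot x=x\}|=f(\xi^d)$, where $\xi$ is a primitive $N$-th complex root of unity. $[m]_q=1+q+\dots+q^{m-1}$; $\begin{bmatrix} m\\ r\end{bmatrix}_q$ is the Gaussian $q$-binomial coefficient, equal to $0$ unless $m\ge r\ge 0$; $\mathbf{Nar}(n,k;q)=\frac{q^{k(k-1)}}{[n]_q}\begin{bmatrix} n\\ k\end{bmatrix}_q\begin{bmatrix} n\\ k-1\end{bmatrix}_q$. $\mathrm{NCM}(n)$ is the set of non-crossing perfect matchings on $2n$ vertices $1,\dots,2n$ placed around a circle, drawn as chords in a disk; the chords of such a matching divide the disk into $n+1$ regions. $\mathrm{NCM}^{(r)}(n)$ is the set of marked non-crossing matchings: a matching in $\mathrm{NCM}(n)$ together with a choice of exactly $r$ of its $n+1$ regions, which are marked. $\mathrm{even}(M)$ is the number of edges $\{i,j\}$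 of the matching with $i<j$ and $i$ even. $\mathrm{rot}_n$ is rotation by $2\pi/n$, i.e. $i\mapsto i+2\pmod{2n}$, acting on the matching and its marked regions; it preserves $\mathrm{even}$. *)

(* Defs.v *)
From mathcomp Require Import all_boot all_order all_fingroup all_algebra all_field.

Set Implicit Arguments.
Unset Strict Implicit.
Unset Printing Implicit Defensive.

Import GroupScope GRing.Theory.

Definition expgz (gT : finGroupType) (g : gT) (d : int) : gT :=
  match d with
  | Posz m => g ^+ m
  | Negz m => g ^- m.+1
  end.

(* The triple (X, C, f) exhibits cyclic sieving, where C = <[g]> is cyclic of
   order N and acts through [to] on a type containing X.  That C maps X to
   itself and that f has non-negative coefficients are part of the property. *)
Definition cyclic_sieving (gT : finGroupType) (T : finType)
    (to : {action gT &-> T}) (X : {set T}) (C : {group gT}) (g : gT) (N : nat)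
    (f : {poly int}) : Prop :=
  [/\ C = <[g]> :> {set gT} /\ #|C| = N,
      [acts C, on X | to],
      (forall i : nat, (0 <= f`_i)%R)
    & forall xi : algC, (N.-primitive_root xi)%R -> forall d : int,
        (#|'Fix_(X | to)[expgz g d]|%:R = (map_poly intr f).[xi ^ d])%R].

Section QAnalogues.

Local Open Scope ring_scope.

Definition qint (m : nat) : {poly int} := \sum_(i < m) 'X^i.

Definition qfact (m : nat) : {poly int} := \prod_(1 <= i < m.+1) qint i.

(* Both q-analogues below are quotients taken in the field Q(q), the fraction
   field of Z[q]; that a value is a polynomial is not built in. *)
Definition qbinom (m r : nat) : {fraction {poly int}} :=
  if (r <= m)%N then
    FracField.tofrac (qfact m) /
      (FracField.tofrac (qfact r) * FracField.tofrac (qfact (m - r)%N))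
  else 0.

(* For k = 0 the factor [n choose k-1]_q vanishes. *)
Definition qNarayana (n k : nat) : {fraction {poly int}} :=
  if k is k'.+1 then
    FracField.tofrac 'X^(k * k')%N / FracField.tofrac (qint n)
      * qbinom n k * qbinom n k'
  else 0.

End QAnalogues.

(* The vertex labelled i + 1, with 1 <= i + 1 <= 2n, is represented by the
   ordinal i.  The 2n boundary arcs cut out by the vertices are indexed by the
   same type: arc i joins vertex i to its cyclic successor [ordS i]. *)
Definition vertex (n : nat) : finType := 'I_(n.*2).

Definition label (n : nat) (i : vertex n) : nat := i.+1.

Definition perfect_matching (n : nat) (M : {set {set vertex n}}) : bool :=
  partition M [set: vertex n] && [forall e in M, #|e| == 2].

Definition crossing (n : nat) (e e' : {set vertex n}) : bool :=
  [exists a in e, exists b in e', exists c in e, exists d in e',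
    [&& a < b, b < c & c < d]].

Definition NCM (n : nat) : {set {set {set vertex n}}} :=
  [set M | perfect_matching M
           && [forall e in M, forall e' in M, ~~ crossing e e']].

(* For a chord {a < b}, the arcs on one of its two sides are those with
   a <= i < b. *)
Definition separates (n : nat) (e : {set vertex n}) (i j : vertex n) : bool :=
  [exists a in e, exists b in e,
    (a < b) && ((a <= i < b) != (a <= j < b))].

(* Every region of the disk meets the boundary circle, and two boundary arcs
   bound the same region exactly when no chord separates them; a region is
   therefore represented by the set of boundary arcs on its frontier. *)
Definition regions (n : nat) (M : {set {set vertex n}}) :
    {set {set vertex n}} :=
  equivalence_partition
    (fun i j : vertex n => [forall e in M, ~~ separates e i j])
    [set: vertex n].

(* A pair (M, S) is a matching M together with the set S of marked regions. *)
Definition marked (n : nat) : finType :=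
  ({set {set vertex n}} * {set {set vertex n}})%type.

Definition NCMr (n r : nat) : {set marked n} :=
  [set x : marked n | [&& x.1 \in NCM n, x.2 \subset regions x.1
                        & #|x.2| == r]].

Definition even_edges (n : nat) (M : {set {set vertex n}}) : nat :=
  #|[set e in M | [exists i in e, exists j in e,
                    (label i < label j) && ~~ odd (label i)]]|.

Definition rotn (n : nat) : {perm vertex n} :=
  perm (inj_comp (@ordS_inj n.*2) (@ordS_inj n.*2)).

(* A permutation moves edges (sets of vertices) and regions (sets of arcs)
   elementwise.  Only powers of [rotn n] are used; they move arc i along with
   vertex i. *)
Definition marked_act (n : nat) (x : marked n) (s : {perm vertex n}) :
    marked n :=
  (('P^*^*)%act x.1 s, ('P^*^*)%act x.2 s).

Lemma marked_act_is_action (n : nat) : is_action [set: _] (@marked_act n).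
Proof.
apply: is_total_action => [x | x s t]; rewrite /marked_act.
  by rewrite !act1; case: x.
by rewrite !actM.
Qed.

Canonical marked_action (n : nat) := Action (@marked_act_is_action n).

(* Main.v *)
Require Import Defs.
From mathcomp Require Import all_boot all_order all_fingroup all_algebra all_field.
From mathcomp Require Import all_solvable zify ring.

(** Write 'C for binomials, E(O) for the number of vertices of O with an even
    label, and say that a set O of vertices is balanced when it contains n of
    the 2n vertices.

    Fix a non-crossing matching M and look at it from a boundary arc x: each
    chord is then oriented, and its first end when the circle is run through
    from x onwards is its opener.  Two arcs have the same set of openers exactly
    when no chord separates them, so regions of M are the same thing as the
    opener sets of M.  Conversely, by parenthesis matching, every balanced set
    is the opener set of one region of one non-crossing matching
    ([ncmap_exists], [ncmap_unique]).  Hence pairs (matching, region) are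
    balanced sets, compatibly with rotation.

    Passing from an arc to the next one swaps one opener for its partner, which
    has the other parity.  So all the arcs on the frontier of a region have
    labels of the same parity, its colour, and for a matching with even(M) = k
    the opener set O of a region has E(O) = k or k + 1 according to the colour
    ([nodd_openers]).  The regions other than that of x correspond to the
    openers from x ([openers_setE]); so there are n + 1 of them, of which k + 1
    have the first colour and n - k the second.  Counting the balanced sets with
    E(O) = j gives, for the number N_k of matchings,
        'C(n, j)^2 = (j + 1) N_j + (n - j + 1) N_(j-1),
    which determines N_k, and also the number of balanced sets of each colour
    ([narayana_count]).

    Let now g be a rotation of order m > 1, with n = m t.  A matching fixed by g
    has exactly one region fixed by g: two such regions would give a fixed
    opener, and there is one because the n + 1 regions are permuted by a
    subgroup of prime order p dividing n ([fixed_ops_uniq],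
    [fixed_region_exists]).  So the fixed matchings are counted by the g-stable
    balanced sets, which are the t-periodic ones, that is to say the balanced
    sets on 2t vertices; colours are kept and E is multiplied by m
    ([count_fixed_NCM]).  Once a fixed region is chosen, a g-stable set of
    regions is the choice to contain it or not together with a g-stable set of
    openers ([count_fixed_marks]).

    On the other side, with b(n, r) the Gaussian binomials, the q-Narayana
    polynomial is q^(k(k+1)) (b(n-1, k)^2 - q b(n-1, k-1) b(n-1, k+1)).  Its
    coefficients are non-negative by a recursion that proves the q-log-concavity
    of b(n, .) ([qlogcS]), and its values at roots of unity follow from
    absorption identities and the q-Lucas theorem ([ev_qnar], [ev_qbin_succ]).
    They agree with the counts above. *)

Set Implicit Arguments.
Unset Strict Implicit.
Unset Printing Implicit Defensive.

(** * Gaussian binomials and q-Narayana polynomials *)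

Section QBinomial.
Import GRing.Theory Num.Theory.
Local Open Scope ring_scope.

(** Given by the q-Pascal rule, so that polynomiality and non-negativity of the
    coefficients are built in; [qbinomE] compares with the quotient of
    q-factorials. *)
Fixpoint qbin (n r : nat) : {poly int} :=
  match n, r with
  | _, 0%N => 1
  | 0%N, _.+1 => 0
  | n'.+1, r'.+1 => qbin n' r' + 'X^(r'.+1) * qbin n' r'.+1
  end.

Lemma qbinn0 n : qbin n 0 = 1. Proof. by case: n. Qed.

Lemma qbinS n r : qbin n.+1 r.+1 = qbin n r + 'X^(r.+1) * qbin n r.+1.
Proof. by []. Qed.

Lemma qbin_small n r : (n < r)%N -> qbin n r = 0.
Proof.
elim: n r => [|n IHn] [|r] //= ltnr.
by rewrite !IHn ?mulr0 ?addr0 //; lia.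
Qed.

Lemma qint0 : qint 0 = 0. Proof. exact: big_ord0. Qed.

Lemma qintD a b : qint (a + b) = qint a + 'X^a * qint b.
Proof.
rewrite /qint big_split_ord mulr_sumr /=; congr (_ + _).
by apply: eq_bigr => i _; rewrite exprD.
Qed.

Lemma qint1 : qint 1 = 1.
Proof. by rewrite /qint big_ord1 expr0. Qed.

Lemma qint_neq0 n : qint n.+1 != 0.
Proof.
apply/eqP => /(congr1 (fun p : {poly int} => p.[1])).
rewrite horner0 horner_sum (eq_bigr (fun=> 1)); last first.
  by move=> i _; rewrite hornerXn expr1n.
by rewrite sumr_const card_ord => /eqP; rewrite pnatr_eq0.
Qed.

Lemma qfact0 : qfact 0 = 1. Proof. exact: big_geq. Qed.

Lemma qfactS n : qfact n.+1 = qfact n * qint n.+1.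
Proof. exact: big_nat_recr. Qed.

Lemma qfact_neq0 n : qfact n != 0.
Proof.
by elim: n => [|n IHn]; rewrite ?qfact0 ?oner_eq0 // qfactS mulf_neq0 ?qint_neq0.
Qed.

Lemma qbin_fact n r :
  (r <= n)%N -> qbin n r * (qfact r * qfact (n - r)%N) = qfact n.
Proof.
elim: n r => [|n IHn] [|r] // lern; rewrite ?qbinn0 ?qfact0 ?mul1r ?subn0 //.
rewrite qbinS subSS qfactS [RHS]qfactS mulrDl.
have -> : qint n.+1 = qint r.+1 + 'X^(r.+1) * qint (n - r)%N.
  by rewrite -qintD; congr qint; lia.
rewrite [RHS]mulrDr -{1}(IHn r lern).
have [ltrn|] := ltnP r n; last first.
  move=> lenr; rewrite (@qbin_small n r.+1) ?ltnS // (_ : (n - r)%N = 0%N) ?qint0.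
    by ring.
  by lia.
rewrite -(IHn r.+1 ltrn) qfactS.
have -> : qfact (n - r)%N = qfact (n - r.+1)%N * qint (n - r)%N.
  by rewrite (_ : n - r = (n - r.+1).+1)%N ?qfactS //; lia.
ring.
Qed.

Lemma qbinnn n : qbin n n = 1.
Proof.
apply: (mulIf (qfact_neq0 n)); rewrite mul1r.
by have := qbin_fact (leqnn n); rewrite subnn qfact0 mulr1.
Qed.

Lemma qbin_absorb n r :
  qint r.+1 * qbin n.+1 r.+1 = qint n.+1 * qbin n r.
Proof.
have [lern|ltnr] := leqP r n; last by rewrite !qbin_small ?mulr0.
apply: (mulIf (mulf_neq0 (qfact_neq0 r) (qfact_neq0 (n - r)))).
rewrite -[RHS]mulrA qbin_fact // mulrC -(mulrC (qfact n)) -qfactS.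
by rewrite -(@qbin_fact n.+1 r.+1) // subSS qfactS; ring.
Qed.

Lemma qbin_absorb_sub n r :
  qint (n.+1 - r)%N * qbin n.+1 r = qint n.+1 * qbin n r.
Proof.
have [lern|ltnr] := leqP r n; last first.
  by rewrite (qbin_small ltnr) (_ : n.+1 - r = 0)%N ?qint0 ?mul0r ?mulr0 //; lia.
apply: (mulIf (mulf_neq0 (qfact_neq0 r) (qfact_neq0 (n - r)))).
rewrite -[RHS]mulrA qbin_fact // mulrC -(mulrC (qfact n)) -qfactS.
by rewrite -(@qbin_fact n.+1 r) 1?leqW // subSn // qfactS; ring.
Qed.

Lemma qbinomE n r : qbinom n r = FracField.tofrac (qbin n r).
Proof.
rewrite /qbinom; case: leqP => [lern|ltnr]; last by rewrite qbin_small ?raddf0.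
apply: (canLR (mulfK _)); last by rewrite -!rmorphM qbin_fact.
by rewrite -rmorphM tofrac_eq0 mulf_neq0 ?qfact_neq0.
Qed.

Definition nneg_coefs (p : {poly int}) := forall i, 0 <= p`_i.

Lemma nneg_coefs0 : nneg_coefs 0. Proof. by move=> i; rewrite coef0. Qed.

Lemma nneg_coefsXn n : nneg_coefs 'X^n.
Proof. by move=> i; rewrite coefXn ler0n. Qed.

Lemma nneg_coefsD p q : nneg_coefs p -> nneg_coefs q -> nneg_coefs (p + q).
Proof. by move=> p_ge0 q_ge0 i; rewrite coefD addr_ge0. Qed.

Lemma nneg_coefsM p q : nneg_coefs p -> nneg_coefs q -> nneg_coefs (p * q).
Proof.
by move=> p_ge0 q_ge0 i; rewrite coefM sumr_ge0 // => j _; rewrite mulr_ge0.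
Qed.

Lemma qbin_nneg n r : nneg_coefs (qbin n r).
Proof.
elim: n r => [|n IHn] [|r] /=; try exact: nneg_coefs0.
- by rewrite -(expr0 'X); apply: nneg_coefsXn.
- by rewrite -(expr0 'X); apply: nneg_coefsXn.
- by apply: nneg_coefsD => //; apply: nneg_coefsM => //; apply: nneg_coefsXn.
Qed.

Definition qbin_pred n k := if k is k'.+1 then qbin n k' else 0.

Lemma qbinS_pred n k : qbin n.+1 k = qbin_pred n k + 'X^k * qbin n k.
Proof. by case: k => [|k] //; rewrite !qbinn0 expr0 mul1r add0r. Qed.

Lemma qbin_predS n k : qbin_pred n k.+1 = qbin n k. Proof. by []. Qed.

(** The difference b(n,k) b(n,l) - q^(l-k+1) b(n,k-1) b(n,l+1) with l = k + d.
    Only d = 0 is wanted, but the recursion below mixes all values of d. *)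
Definition qlogc n k d : {poly int} :=
  qbin n k * qbin n (k + d) - 'X^(d.+1) * qbin_pred n k * qbin n (k + d).+1.

(** Expanding the four Gaussian binomials by the q-Pascal rule, the terms in
    q^l cancel and the others group into smaller differences with monomial
    coefficients; the second group is a sum of two consecutive differences,
    and one of them vanishes for d = 0. *)
Lemma qlogcS n k d :
  qlogc n.+1 k.+1 d =
    qlogc n k d + 'X^(k.+1) * (if d is d'.+1 then qlogc n k.+1 d' else 0)
    + 'X^(k.+1 + d) * qlogc n k d.+1 + 'X^(k.+1 + k.+1 + d) * qlogc n k.+1 d.
Proof.
rewrite /qlogc !qbin_predS (qbinS_pred n k).
rewrite !addSn !qbinS addnS.
case: d => [|d]; first by rewrite !addn0 !(exprS, exprD, expr0); ring.
by rewrite -!addSnnS !(addSn, exprS, exprD); ring.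
Qed.

Lemma qlogc_nneg n k d : nneg_coefs (qlogc n k d).
Proof.
have qbinM_nneg a b c e : nneg_coefs (qbin a b * qbin c e).
  by apply: nneg_coefsM; apply: qbin_nneg.
elim: n k d => [|n IHn] [|k] d; rewrite /qlogc.
- by rewrite [qbin_pred _ _]/= ?mulr0 ?mul0r subr0.
- rewrite !addSn (@qbin_small 0 k.+1) // (@qbin_small 0 (k + d).+2) // mul0r mulr0 subrr.
  exact: nneg_coefs0.
- by rewrite [qbin_pred _ _]/= ?mulr0 ?mul0r subr0.
- rewrite -/(qlogc n.+1 k.+1 d) qlogcS.
  (apply: nneg_coefsD; [apply: nneg_coefsD; [apply: nneg_coefsD|]|]);
    try exact: IHn;
    apply: nneg_coefsM; try exact: nneg_coefsXn; try exact: IHn.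
  by case: d => [|d]; [apply: nneg_coefs0 | apply: IHn].
Qed.

(** A form of the q-Narayana polynomial Nar(n, k+1; q) without division. *)
Definition qnar n k : {poly int} := 'X^(k.+1 * k) * qlogc n.-1 k 0.

Lemma qnar_nneg n k : nneg_coefs (qnar n k).
Proof. by apply: nneg_coefsM; [apply: nneg_coefsXn | apply: qlogc_nneg]. Qed.

Lemma qbin_ratio n k : qint k.+1 * qbin n k.+1 = qint (n - k)%N * qbin n k.
Proof.
apply: (mulfI (qint_neq0 n)); rewrite mulrCA -qbin_absorb_sub subSS.
by rewrite mulrCA qbin_absorb mulrCA.
Qed.

(** This and the next lemma express the q-Narayana polynomial by one product of
    binomials up to a factor [k+1] or [n-k] (with n + 1 for n here); at a root of
    unity whose order m > 1 divides n at least one of the two factors is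
    non-zero, whereas the factor [n] of the definition vanishes. *)
Lemma qlogc0_absorb n k :
  qint k.+1 * qlogc n k 0 = qbin n.+1 k * qbin n k.
Proof.
have [lenk|ltnk] := leqP k n; last first.
  by rewrite /qlogc addn0 (qbin_small ltnk) (qbin_small (leqW ltnk)) !mulr0 subrr mulr0.
rewrite /qlogc addn0 expr1 mulrBr (qbinS_pred n k).
rewrite (mulrCA _ _ (qbin n k.+1)) qbin_ratio.
have -> : qint k.+1 = qint k + 'X^k by rewrite -addn1 qintD qint1 mulr1.
case: k lenk => [|k] lenk /=; first by rewrite qint0 !expr0; ring.
have e : qint k.+1 * qbin n k.+1 = (1 + 'X * qint (n - k.+1)%N) * qbin n k.
  rewrite qbin_ratio; congr (_ * _).
  by rewrite -qint1 -{1}['X]expr1 -qintD; congr qint; lia.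
by rewrite mulrDl (mulrA (qint k.+1)) e; ring.
Qed.

Lemma qlogc0_absorb_sub n k :
  qint (n.+1 - k)%N * qlogc n k 0 = qbin n k * qbin n.+1 k.+1.
Proof.
apply: (mulfI (qint_neq0 k)); rewrite mulrCA qlogc0_absorb.
by rewrite mulrA -qbin_ratio; ring.
Qed.

Lemma qlogc0_qbin n k :
  qint n.+1 * qlogc n k 0 = qbin n.+1 k.+1 * qbin n.+1 k.
Proof.
apply: (mulfI (qint_neq0 k)); rewrite mulrCA qlogc0_absorb.
by rewrite mulrCA -qbin_absorb; ring.
Qed.

Lemma qNarayanaE n k :
  (0 < n)%N -> qNarayana n k.+1 = FracField.tofrac (qnar n k).
Proof.
case: n => // n _; rewrite /qNarayana !qbinomE /qnar [n.+1.-1]/=.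
rewrite -!mulrA -rmorphM -qlogc0_qbin !rmorphM mulKf //=.
by rewrite tofrac_eq0 qint_neq0.
Qed.

(** * Values at roots of unity *)

Local Notation ev p z := ((map_poly (intr : int -> algC) p).[z]).

Lemma ev_qint1 n : ev (qint n) 1 = n%:R.
Proof.
rewrite /qint rmorph_sum horner_sum (eq_bigr (fun=> 1)).
  by rewrite sumr_const card_ord.
by move=> i _; rewrite /= map_polyXn hornerXn expr1n.
Qed.

Lemma ev_qbinn0 z n : ev (qbin n 0) z = 1.
Proof. by rewrite qbinn0 rmorph1 hornerC. Qed.

Lemma ev_qbin_small z n r : (n < r)%N -> ev (qbin n r) z = 0.
Proof. by move=> ltnr; rewrite qbin_small // rmorph0 horner0. Qed.

Lemma ev_qbinS z n r :
  ev (qbin n.+1 r.+1) z = ev (qbin n r) z + z ^+ r.+1 * ev (qbin n r.+1) z.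
Proof. by rewrite qbinS rmorphD rmorphM hornerD hornerM /= map_polyXn hornerXn. Qed.

Lemma ev_qbin1 n r : ev (qbin n r) 1 = 'C(n, r)%:R.
Proof.
elim: n r => [|n IHn] [|r]; rewrite ?ev_qbinn0 ?bin0 //.
  by rewrite rmorph0 horner0.
by rewrite ev_qbinS !IHn expr1n mul1r binS natrD addrC.
Qed.

Section AtRootOfUnity.
Variables (m : nat) (z : algC).
Hypotheses (m_gt1 : (1 < m)%N) (z_prim : m.-primitive_root z).

Lemma ev_qint_mul j : (z - 1) * ev (qint j) z = z ^+ j - 1.
Proof.
rewrite subrX1 /qint rmorph_sum horner_sum; congr (_ * _).
by apply: eq_bigr => i _; rewrite /= map_polyXn hornerXn.
Qed.

Lemma prim_neq1 : z - 1 != 0.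
Proof.
rewrite subr_eq0 -[X in X == _]expr1 -(prim_order_dvd z_prim).
by rewrite dvdn1; lia.
Qed.

Lemma ev_qint_eq0 j : (ev (qint j) z == 0) = (m %| j)%N.
Proof.
rewrite -(inj_eq (mulfI prim_neq1)) mulr0 ev_qint_mul subr_eq0.
by rewrite (prim_order_dvd z_prim).
Qed.

Lemma ev_qint_eq1 j : (m %| j)%N -> ev (qint j.+1) z = 1.
Proof.
move=> dvdmj; apply: (mulfI prim_neq1); rewrite ev_qint_mul mulr1 exprS.
by move: dvdmj; rewrite (prim_order_dvd z_prim) => /eqP->; rewrite mulr1.
Qed.

(** [m]! vanishes at a primitive m-th root of unity z, but no smaller
    q-factorial does. *)
Lemma ev_qbin_full r :
  ev (qbin m r) z = (r == 0)%:R + (r == m)%:R.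
Proof.
have m_gt0 : (0 < m)%N by lia.
have [->|r_gt0] := posnP r.
  by rewrite ev_qbinn0 (_ : 0%N == m = false) ?addr0 //; lia.
rewrite add0r; have [->|neq_rm] := eqVneq r m; first by rewrite qbinnn rmorph1 hornerC.
have [ltmr|lerm] := ltnP m r; first by rewrite ev_qbin_small.
have ltrm : (r < m)%N by lia.
apply/eqP; have := congr1 (fun p => ev p z) (qbin_absorb m.-1 r.-1).
rewrite !prednK // !rmorphM !hornerM /= => eq_ev; move/eqP: eq_ev.
have /eqP-> : ev (qint m) z == 0 by rewrite ev_qint_eq0.
rewrite mul0r mulf_eq0 ev_qint_eq0 => /orP[/dvdn_leq|] //; lia.
Qed.

(** Both sides satisfy the same q-Pascal recursion in n, since z^r depends on r
    modulo m only; so the case n = 0 suffices. *)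
Lemma ev_qbinD n r :
  ev (qbin (n + m) r) z
    = ev (qbin n r) z + (if (m <= r)%N then ev (qbin n (r - m)) z else 0).
Proof.
elim: n r => [|n IHn] r.
  rewrite add0n ev_qbin_full; case: r => [|r].
    by rewrite ev_qbinn0 leqn0; case: (m) m_gt1.
  rewrite (ev_qbin_small _ (ltn0Sn r)).
  have [eq_mr|neq_mr] := eqVneq r.+1 m.
    by rewrite -eq_mr leqnn subnn ev_qbinn0 !add0r.
  rewrite addr0 !add0r; case: ifP => // lemr; symmetry.
  by rewrite ev_qbin_small //; lia.
case: r => [|r].
  by rewrite !ev_qbinn0 leqn0 (_ : m == 0%N = false) ?addr0 //; lia.
rewrite addSn !ev_qbinS !IHn.
have [ler|gtr] := leqP m r.
  have -> : z ^+ r.+1 = z ^+ (r - m).+1.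
    by rewrite -subSn // -{1}(subnK (leqW ler)) exprD (prim_expr_order z_prim) mulr1.
  by rewrite (leqW ler) subSn // ev_qbinS; ring.
have [ler|//] := leqP m r.+1; last by rewrite !addr0.
have <- : m = r.+1 by lia.
by rewrite subnn !ev_qbinn0 (prim_expr_order z_prim); ring.
Qed.

(** The q-Lucas theorem. *)
Lemma ev_qbin_lucas t s u v : (s < m)%N -> (v < m)%N ->
  ev (qbin (m * t + s) (m * u + v)) z = 'C(t, u)%:R * ev (qbin s v) z.
Proof.
move=> ltsm ltvm; elim: t u => [|t IHt] u.
  case: u => [|u]; first by rewrite !muln0 !add0n bin0 mul1r.
  rewrite bin0n mul0r muln0 ev_qbin_small //.
  by rewrite mulnS; lia.
have -> : (m * t.+1 + s = m * t + s + m)%N by rewrite mulnS; lia.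
rewrite ev_qbinD IHt; case: u => [|u].
  by rewrite muln0 add0n leqNgt ltvm /= addr0 !bin0.
have -> : (m * u.+1 + v = m * u + v + m)%N by rewrite mulnS; lia.
by rewrite leq_addl addnK IHt binS natrD mulrDl.
Qed.

(** At most one of k and k + 1 is divisible by m.  If it is k, then [k+1] has
    value 1; if it is k + 1, then [n-k] has value 1, unless
    k >= n, when both sides are 0; otherwise [k+1] does not
    vanish but b(n, k) does. *)
Lemma ev_qnar t k : (0 < t)%N ->
  ev (qnar (m * t) k) z =
    ((m %| k) * ('C(t, k %/ m) * 'C(t.-1, k %/ m))
     + (m %| k.+1) * ('C(t, k.+1 %/ m) * 'C(t.-1, (k.+1 %/ m).-1)))%:R.
Proof.
move=> t_gt0; have m_gt0 : (0 < m)%N by lia.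
have n_gt0 : (0 < m * t)%N by rewrite muln_gt0 m_gt0.
have nE : (m * t).-1 = (m * t.-1 + m.-1)%N.
  by rewrite -{1}(prednK t_gt0) mulnS; lia.
have ev_full u v : (v < m)%N -> ev (qbin (m * t) (m * u + v)) z = ('C(t, u) * (v == 0))%:R.
  move=> ltvm; rewrite -[(m * t)%N]addn0 ev_qbin_lucas // natrM; congr (_ * _).
  by case: v ltvm => [|v] _; rewrite ?ev_qbinn0 ?ev_qbin_small.
have ev_pred u v : (v < m)%N -> ev (qbin (m * t).-1 (m * u + v)) z =
    'C(t.-1, u)%:R * ev (qbin m.-1 v) z.
  by move=> ltvm; rewrite nE ev_qbin_lucas //; lia.
rewrite /qnar rmorphM hornerM /= map_polyXn hornerXn.
have zX1 : (m %| k.+1 * k)%N -> z ^+ (k.+1 * k) = 1.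
  by rewrite (prim_order_dvd z_prim) => /eqP.
case dvd_k: (m %| k)%N.
  have -> : (m %| k.+1)%N = false.
    by rewrite -addn1 dvdn_addr // dvdn1; lia.
  rewrite mul1n mul0n addn0 zX1 ?dvdn_mull // mul1r.
  have := congr1 (fun p => ev p z) (qlogc0_absorb (m * t).-1 k).
  rewrite (prednK n_gt0) !rmorphM !hornerM /= ev_qint_eq1 // mul1r => ->.
  have kE : k = (m * (k %/ m) + 0)%N by rewrite addn0 mulnC divnK.
  rewrite [in LHS]kE ev_full // ev_pred //.
  by rewrite ev_qbinn0 mulr1 muln1.
rewrite mul0n add0n; case dvd_k1: (m %| k.+1)%N; last first.
  rewrite mul0n; apply/eqP; rewrite mulf_eq0; apply/orP; right.
  have := congr1 (fun p => ev p z) (qlogc0_absorb (m * t).-1 k).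
  rewrite (prednK n_gt0) !rmorphM !hornerM /= => /eqP.
  rewrite [in qbin (m * t) k](divn_eq k m) [(_ * m)%N]mulnC ev_full ?ltn_mod //.
  rewrite -/(m %| k)%N dvd_k.
  by rewrite muln0 mul0r mulf_eq0 ev_qint_eq0 dvd_k1.
rewrite mul1n zX1 ?dvdn_mulr // mul1r.
have [a def_k] : exists a, k.+1 = (m * a.+1)%N.
  case/dvdnP: dvd_k1 => [[|a]] // ->; exists a; exact: mulnC.
have kE : k = (m * a + m.-1)%N by move: def_k; rewrite mulnS; lia.
rewrite def_k mulKn //=.
have [lean|gtan] := leqP a.+1 t; last first.
  rewrite bin_small // mul0n /qlogc addn0 !qbin_small ?mulr0 ?subrr ?rmorph0 ?horner0 //;
    move: n_gt0 gtan; rewrite -ltnS -(leq_pmul2l m_gt0) -?def_k; nia.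
have := congr1 (fun p => ev p z) (qlogc0_absorb_sub (m * t).-1 k).
rewrite (prednK n_gt0) !rmorphM !hornerM /=.
have -> : (m * t - k = (m * (t - a.+1)).+1)%N.
  rewrite mulnBr -def_k; have : (k.+1 <= m * t)%N by rewrite def_k leq_mul2l lean orbT.
  by lia.
rewrite ev_qint_eq1 ?dvdn_mulr // mul1r => ->.
rewrite {1}kE def_k -[(m * a.+1)%N]addn0 ev_pred ?ev_full //; last lia.
by rewrite qbinnn rmorph1 hornerC mulr1 muln1 mulrC.
Qed.

Lemma ev_qbin_succ t r :
  ev (qbin (m * t).+1 r) z =
    ((m %| r) * 'C(t, r %/ m)
     + (0 < r)%N * ((m %| r.-1) * 'C(t, r.-1 %/ m)))%:R.
Proof.
have m_gt0 : (0 < m)%N by lia.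
rewrite -addn1 {1}(divn_eq r m) [(_ * m)%N]mulnC ev_qbin_lucas ?ltn_mod //.
move: (divn_eq r m) (ltn_pmod r m_gt0).
have -> : (m %| r)%N = (r %% m == 0)%N by [].
move: (r %/ m)%N (r %% m)%N => u v def_r ltvm.
case: v => [|[|v]] in def_r ltvm *.
- rewrite ev_qbinn0 mulr1 mul1n; case: r def_r => [|r] def_r; first by rewrite addn0.
  rewrite [r.+1.-1]/= (_ : (m %| r)%N = false) ?mul0n ?muln0 ?addn0 //.
  apply/negP => dvd_r; have : (m %| r.+1)%N by rewrite def_r addn0 dvdn_mull.
  by rewrite -addn1 dvdn_addr // dvdn1; lia.
- rewrite qbinnn rmorph1 hornerC mulr1 def_r addn1 /= mul0n add0n mul1n.
  by rewrite dvdn_mull // mulnK // mul1n.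
- rewrite ev_qbin_small // mulr0 mul0n add0n def_r addnS /=.
  rewrite (_ : (m %| _)%N = false) ?mul0n ?muln0 //.
  by rewrite dvdn_addr ?dvdn_mull // /dvdn modn_small //; lia.
Qed.

End AtRootOfUnity.

End QBinomial.

(* Otherwise simplification unfolds b(n.+1, r) into its q-Pascal form. *)
#[global] Arguments qbin : simpl never.

(** * Arcs on a circle *)

Section Circle.
Variable n : nat.
Implicit Types (u v w x y z : vertex n) (O : {set vertex n}) (h : vertex n -> nat).

Lemma val_ordS x : ordS x = (if x.+1 == n.*2 then 0 else x.+1) :> nat.
Proof.
have := ltn_ord x; rewrite leq_eqVlt /= => /orP[/eqP->|ltx]; first by rewrite eqxx modnn.
by rewrite modn_small // (ltn_eqF ltx).
Qed.

(** Membership of arc x in the cyclic interval of the arcs met when going from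
    vertex v to vertex w; the last summand accounts for the passage through
    the origin when w < v. *)
Definition inarc v w x : bool := (v <= x) (+) (w <= x) (+) (w < v).

(** Position of v when the circle is cut open at arc x, so that the vertex
    after x comes first and x itself, as a vertex, comes last. *)
Definition pos x v : nat := v + (if x < v then 0 else n.*2) - x.+1.

Lemma eq_ord_val v w : (v == w) = (v == w :> nat).
Proof. by []. Qed.

Lemma neq_ord_val v w : (v != w) = (v != w :> nat).
Proof. by []. Qed.

Lemma pos_lt x v : pos x v < n.*2.
Proof. by rewrite /pos; have := ltn_ord x; have := ltn_ord v; case: (ltnP x v); lia. Qed.

Lemma pos_inj x : injective (pos x).
Proof.
move=> v w; rewrite /pos; have := ltn_ord x; have := ltn_ord v; have := ltn_ord w.
by case: (ltnP x v) => ?; case: (ltnP x w) => ? *; apply: ord_inj; lia.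
Qed.

Lemma pos_refl x : (pos x x).+1 = n.*2.
Proof. by rewrite /pos ltnn; have := ltn_ord x; lia. Qed.

Lemma pos_le_base x v : pos x v <= pos x x.
Proof. by have := pos_lt x v; rewrite -(pos_refl x) ltnS. Qed.

Lemma pos_ordS x y : y != x -> pos x (ordS y) = (pos x y).+1.
Proof.
rewrite neq_ord_val /pos val_ordS; have := ltn_ord x; have := ltn_ord y.
by case: (y.+1 =P n.*2) => eq_y *; case: (ltnP x y) => ?; case: (ltnP x _) => ?; lia.
Qed.

Lemma pos_start x : pos x (ordS x) = 0.
Proof.
rewrite /pos val_ordS; case: eqP => [eqx|_]; rewrite ?ltn0 ?ltnSn ?addn0 ?subnn //.
by rewrite add0n eqx subnn.
Qed.

(** The definition of [inarc] cuts the circle at the origin; cutting it at any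
    other arc x gives the same cyclic intervals. *)
Lemma inarc_pos x v w y :
  v != w -> inarc v w y = (pos x v <= pos x y) (+) (pos x w <= pos x y) (+) (pos x w < pos x v).
Proof.
rewrite neq_ord_val /inarc /pos.
have := ltn_ord x; have := ltn_ord y; have := ltn_ord v; have := ltn_ord w.
by case: (ltnP x v) => ?; case: (ltnP x w) => ?; case: (ltnP x y) => *; lia.
Qed.

Lemma inarc_ordS v w x : v != w ->
  inarc v w (ordS x) = inarc v w x (+) (v == ordS x) (+) (w == ordS x).
Proof.
rewrite !eq_ord_val /inarc val_ordS.
have := ltn_ord x; have := ltn_ord v; have := ltn_ord w.
by case: (x.+1 =P n.*2) => *; lia.
Qed.

Lemma inarcC v w x : v != w -> inarc w v x = ~~ inarc v w x.
Proof. by rewrite neq_ord_val /inarc; lia. Qed.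

Lemma inarc_start v w : v != w -> inarc v w v.
Proof. by rewrite neq_ord_val /inarc; lia. Qed.

Lemma inarc_end v w : v != w -> inarc v w w = false.
Proof. by rewrite neq_ord_val /inarc; lia. Qed.

Lemma inarc_rotate v w x : v != w -> inarc (ordS v) (ordS w) (ordS x) = inarc v w x.
Proof.
rewrite neq_ord_val /inarc !val_ordS.
have := ltn_ord x; have := ltn_ord v; have := ltn_ord w.
by case: (x.+1 =P n.*2); case: (v.+1 =P n.*2); case: (w.+1 =P n.*2) => *; lia.
Qed.

(** Induction around the circle. *)
Lemma ordS_ind x (P : vertex n -> Prop) :
  P x -> (forall y, P y -> P (ordS y)) -> forall y, P y.
Proof.
move=> Px PS y; move: {2}(pos x y).+1 (ltnSn (pos x y)) => k.
elim: k y => // k IHk y; rewrite ltnS => le_yk.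
have [->//|neq_yx] := eqVneq y x.
rewrite -(ord_predK y); apply: PS.
have [->//|neq_zx] := eqVneq (ord_pred y) x; apply: IHk.
by move: (pos_ordS neq_zx); rewrite ord_predK => <-.
Qed.

Lemma odd_ordS x : odd (ordS x) = ~~ odd x.
Proof.
by rewrite val_ordS; case: eqP => // x_last; have := congr1 odd x_last; rewrite odd_double /= => ->.
Qed.

(** * Heights *)

(** A height, on arcs, goes up at the vertices of O and down at the others. *)
Definition is_height O h :=
  forall y, if ordS y \in O then h (ordS y) = (h y).+1 else h y = (h (ordS y)).+1.

Lemma heights_shift O h h' x y :
  is_height O h -> is_height O h' -> h y + h' x = h' y + h x.
Proof.
move=> hO h'O; elim/(@ordS_ind x): y => [|y IHy]; first exact: addnC.
by have := hO y; have := h'O y; case: ifP => _; lia.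
Qed.

(** Ups minus downs, up to y, shifted by n to stay in [nat]: the downs
    after y are counted in place of minus those up to y. *)
Definition bal_height O y := #|[set u in O | u <= y]| + #|[set u in ~: O | y < u]|.

Lemma bal_heightP O : #|O| = n -> is_height O (bal_height O).
Proof.
move=> cardO y; rewrite /bal_height; set y' := ordS y.
have cardC : #|~: O| = n by have := cardsC O; rewrite card_ord cardO; lia.
have := val_ordS y; rewrite -/y'; case: eqP => [y_last|y_small] y'E; last first.
  have -> : [set u in O | u <= y'] = [set u in O | u <= y] :|: [set u in O | u == y'].
    by apply/setP=> u; rewrite !inE eq_ord_val -andb_orr; congr (_ && _); lia.
  have -> : [set u in ~: O | y < u] = [set u in ~: O | y' < u] :|: [set u in ~: O | u == y'].
    by apply/setP=> u; rewrite !inE eq_ord_val -andb_orr; congr (_ && _); lia.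
  case: ifP => Oy'.
    have -> : [set u in O | u == y'] = [set y'].
      by apply/setP=> u; rewrite !inE; case: eqP => [->|]; rewrite ?Oy' ?andbF.
    have -> : [set u in ~: O | u == y'] = set0.
      by apply/setP=> u; rewrite !inE; case: eqP => [->|]; rewrite ?Oy' ?andbF.
    by rewrite setU0 setUC cardsU1 !inE y'E ltnn andbF.
  have -> : [set u in O | u == y'] = set0.
    by apply/setP=> u; rewrite !inE; case: eqP => [->|]; rewrite ?Oy' ?andbF.
  have -> : [set u in ~: O | u == y'] = [set y'].
    by apply/setP=> u; rewrite !inE; case: eqP => [->|]; rewrite ?Oy' ?andbF.
  by rewrite setU0 [_ :|: [set y']]setUC cardsU1 !inE ltnn andbF addnS.
have -> : [set u in O | u <= y] = O.
  by apply/setP=> u; rewrite !inE; have := ltn_ord u; case: (_ \in _) => //=; lia.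
have -> : [set u in ~: O | y < u] = set0.
  by apply/setP=> u; rewrite !inE; have := ltn_ord u; case: (_ \in _) => //=; lia.
have -> : [set u in O | u <= y'] = O :&: [set y'].
  by apply/setP=> u; rewrite !inE eq_ord_val; congr (_ && _); lia.
have -> : [set u in ~: O | y' < u] = ~: O :\ y'.
  by apply/setP=> u; rewrite !inE eq_ord_val andbC; congr (_ && _); lia.
rewrite cards0; have := cardsD1 y' (~: O); rewrite inE cardC cardO.
case: ifP => Oy' /=.
  by rewrite (setIidPr _) ?sub1set // cards1 add0n => <-; rewrite addn0.
rewrite (_ : O :&: [set y'] = set0) ?cards0; first by rewrite addn0 add0n add1n.
by apply/setP=> u; rewrite !inE; case: eqP => [->|]; rewrite ?Oy' ?andbF.
Qed.

(** * Non-crossing involutions and their opener sets *)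

(** A non-crossing matching as the fixed-point-free involution that exchanges
    the ends of each chord.  Non-crossing is stated without an origin on the
    circle, which makes it visibly invariant under rotation. *)
Definition ncmap (s : vertex n -> vertex n) : Prop :=
  [/\ involutive s, forall v, v != s v
    & forall u v, u != v -> u != s v ->
        inarc v (s v) u = inarc v (s v) (s u)].

(** Seen from arc x, a chord is oriented from the end met first when the circle
    is run through from x onwards. *)
Definition openers (s : vertex n -> vertex n) x : {set vertex n} :=
  [set v | ~~ inarc v (s v) x].

(** Odd ordinals are the vertices with an even label. *)
Definition nodd O := #|[set v in O | odd v]|.

(** By [low_openers] the lowest arcs of O form one region if O is a set of
    openers.  The parity of a lowest arc is expressed through heights, without
    the matching, because it has to be compared for O and for its periodic
    extension, whose matchings are unrelated a priori. *)
Definition colour O :=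
  [exists x, [forall y, bal_height O x <= bal_height O y] && odd x].

Section OneMatching.
Variable s : vertex n -> vertex n.
Hypothesis ncs : ncmap s.
Notation op := (openers s).

Let sK : involutive s. Proof. by case: ncs. Qed.
Let s_neq v : v != s v. Proof. by case: ncs. Qed.
Let s_nc u v : u != v -> u != s v -> inarc v (s v) u = inarc v (s v) (s u).
Proof. by case: ncs => _ _; apply. Qed.

Lemma eq_mate u v : (s u == v) = (u == s v).
Proof. by rewrite -{1}(sK v) (inj_eq (inv_inj sK)). Qed.

Lemma openers_mate x v : (s v \in op x) = (v \notin op x).
Proof. by rewrite !inE sK inarcC ?s_neq. Qed.

Lemma card_openers x : #|op x| = n.
Proof.
have s_img : s @: op x = ~: op x.
  apply/setP=> v; rewrite -{1}(sK v) (mem_imset _ _ (inv_inj sK)).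
  by rewrite openers_mate in_setC.
have := cardsC (op x); rewrite -s_img card_imset ?card_ord; last exact: inv_inj.
by lia.
Qed.

Lemma openers_ordS x v :
  (v \in op (ordS x)) = (v \in op x) (+) (v == ordS x) (+) (s v == ordS x).
Proof. by rewrite !inE inarc_ordS // !addNb. Qed.

Lemma ordS_in_openers x : ordS x \in op x.
Proof.
have := openers_ordS x (ordS x); rewrite eqxx (negPf (_ : s (ordS x) != _)) 1?eq_sym //.
by rewrite inE inarc_start //=; case: (_ \in _).
Qed.

Lemma openersP x v : (v \in op x) = (pos x v < pos x (s v)).
Proof.
rewrite inE (inarc_pos x x (s_neq v)) !pos_le_base /= -leqNgt leq_eqVlt.
by rewrite (inj_eq (@pos_inj x)) (negPf (s_neq v)).
Qed.

Lemma inarc_opener x v y : v \in op x ->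
  inarc v (s v) y = (pos x v <= pos x y < pos x (s v)).
Proof. by rewrite openersP (inarc_pos x y (s_neq v)); lia. Qed.

Lemma openers_self v : v \notin op v.
Proof. by rewrite inE inarc_start. Qed.

(** The arc before a vertex and the arc after its partner lie on the same
    region. *)
Lemma openers_jump x : op (s (ordS x)) = op x.
Proof.
have ordS_neq : ordS x != s (ordS x) by [].
apply/setP=> u; have := openers_ordS x u.
have [-> _|neq_u] := eqVneq u (ordS x).
  by rewrite (ordS_in_openers x) inE inarc_end.
have [|neq_su] := eqVneq (s u) (ordS x).
  move=> eq_su _; have -> : u = s (ordS x) by rewrite -eq_su sK.
  by rewrite (negPf (openers_self _)) openers_mate (ordS_in_openers x).
rewrite !addbF => <-; rewrite !inE; congr (~~ _); symmetry.
by apply: s_nc; rewrite eq_sym // -eq_mate.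
Qed.

(** Number of chords that separate arcs x and y: they are those whose opener
    changes, and this happens once for each of them. *)
Definition depth x y := #|op x :\: op y|.

Lemma depth_height x : is_height (op x) (depth x).
Proof.
move=> y; set y' := ordS y; rewrite /depth.
have y'y : y' \in op y by exact: ordS_in_openers.
have y'S v : (v \in op y') = (v \in op y) (+) (v == y') (+) (s v == y').
  exact: openers_ordS.
case: ifP => xy'.
  have sxy' : s y' \notin op x by rewrite openers_mate xy'.
  rewrite (_ : op x :\: op y' = y' |: (op x :\: op y)); last first.
    apply/setP=> v; rewrite in_setD in_setU1 in_setD y'S eq_mate.
    have [->|neq_v] := eqVneq v y'; first by rewrite y'y (negPf (s_neq _)) xy'.
    by have [->|_] := eqVneq v (s y'); rewrite ?(negPf sxy') ?andbF // !addbF.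
  by rewrite cardsU1 in_setD y'y.
have sxy' : s y' \in op x by rewrite openers_mate xy'.
have sy'y : s y' \notin op y by rewrite openers_mate y'y.
rewrite (_ : op x :\: op y = s y' |: (op x :\: op y')); last first.
  apply/setP=> v; rewrite in_setD in_setU1 in_setD y'S eq_mate.
  have [->|neq_v] := eqVneq v y'; first by rewrite xy' !andbF (negPf (s_neq _)).
  have [->|_] := eqVneq v (s y'); first by rewrite sxy' sy'y.
  by rewrite !addbF.
by rewrite cardsU1 in_setD y'S sK eqxx sxy' (negPf sy'y) eq_sym (negPf (s_neq _)).
Qed.

Lemma depth_refl x : depth x x = 0.
Proof. by rewrite /depth setDv cards0. Qed.

Lemma depth_eq0 x y : (depth x y == 0) = (op y == op x).
Proof.
rewrite /depth cards_eq0 setD_eq0 eq_sym eqEcard !card_openers leqnn andbT.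
by [].
Qed.

Lemma odd_depth x y : odd (depth x y) = odd x (+) odd y.
Proof.
elim/(@ordS_ind x): y => [|y IHy]; first by rewrite depth_refl addbb.
have := depth_height x y; rewrite odd_ordS; case: ifP => _.
  by move=> ->; rewrite /= IHy; case: (odd x); case: (odd y).
by move=> eq_d; move: IHy; rewrite eq_d /=; case: (odd x); case: (odd y); case: (odd _).
Qed.

(** The arcs on the two outer sides of a chord have the same openers, hence
    depth 0 from each other; and depth has the parity of the distance. *)
Lemma odd_mate v : odd (s v) = ~~ odd v.
Proof.
rewrite -(ord_predK v) odd_ordS negbK; move: (ord_pred v) => x.
have := odd_depth x (s (ordS x)).
have /eqP := openers_jump x; rewrite -depth_eq0 => /eqP-> /=.
by case: (odd _); case: (odd _).
Qed.

(** A step along the circle replaces the vertex passed by its partner, which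
    has the opposite parity. *)
Lemma nodd_openers x y : nodd (op x) + odd x = nodd (op y) + odd y.
Proof.
elim/(@ordS_ind y): x => // x <-; set x' := ordS x.
have x'x : x' \in op x by exact: ordS_in_openers.
have x'S v : (v \in op x') = (v \in op x) (+) (v == x') (+) (s v == x').
  exact: openers_ordS.
have sx'x : s x' \notin op x by rewrite openers_mate x'x.
have odd_x' : odd x' = ~~ odd x by exact: odd_ordS.
have odd_sx' : odd (s x') = odd x by rewrite odd_mate odd_x' negbK.
rewrite /nodd odd_x'; case odd_x: (odd x) odd_x' odd_sx' => /= odd_x' odd_sx'.
  rewrite (_ : [set v in op x' | odd v] = s x' |: [set v in op x | odd v]).
    by rewrite cardsU1 in_set (negPf sx'x) addn0 addnC.
  apply/setP=> v; rewrite in_set in_setU1 in_set x'S eq_mate.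
  have [->|_] := eqVneq v x'; first by rewrite odd_x' !andbF (negPf (s_neq _)).
  have [->|_] := eqVneq v (s x'); first by rewrite (negPf sx'x) odd_sx'.
  by rewrite !addbF.
rewrite (_ : [set v in op x | odd v] = x' |: [set v in op x' | odd v]).
  rewrite cardsU1 in_set x'S x'x eqxx [s x' == _]eq_sym (negPf (s_neq _)).
  by rewrite addn0 addnC.
apply/setP=> v; rewrite in_set in_setU1 in_set x'S eq_mate.
have [->|_] := eqVneq v x'; first by rewrite x'x odd_x'.
have [->|_] := eqVneq v (s x'); first by rewrite odd_sx' !andbF.
by rewrite !addbF.
Qed.

(** The region on the inner side of the chord opened by v is that of the arc
    after v; distinct chords have distinct inner regions. *)
Lemma openers_opener_inj x : {in op x &, injective op}.
Proof.
move=> v w xv xw eq_op.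
have := openers_self v; rewrite eq_op inE negbK (inarc_opener _ xv) => /andP[le_vw _].
have := openers_self w; rewrite -eq_op inE negbK (inarc_opener _ xw) => /andP[le_wv _].
by apply: (@pos_inj x); apply/eqP; rewrite eqn_leq le_vw.
Qed.

(** Every region but that of x is the inner region of a chord.  If y is not an
    opener, then its region continues before the opener of the chord that ends
    at y, which is closer to x. *)
Lemma openers_cover x y : op y = op x \/ exists2 v, v \in op x & op y = op v.
Proof.
move: {2}(pos x y).+1 (ltnSn (pos x y)) => k; elim: k y => // k IHk y le_yk.
have [xy|nxy] := boolP (y \in op x); first by right; exists y.
have x_sy : s y \in op x by rewrite openers_mate.
move: (x_sy); rewrite openersP sK => lt_sy.
have := openers_jump (ord_pred (s y)); rewrite ord_predK sK => ->.
have [->|neq_zx] := eqVneq (ord_pred (s y)) x; first by left.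
apply: IHk; have := pos_ordS neq_zx; rewrite ord_predK; lia.
Qed.

Definition openers_set := [set op x | x : vertex n].

Lemma openers_setE x : openers_set = op x |: [set op v | v in op x].
Proof.
apply/setP=> O; rewrite in_setU1; apply/imsetP/orP => [[y _ ->]|].
  by have [->|[v xv ->]] := openers_cover x y; [left | right; exact: imset_f].
by case=> [/eqP->|/imsetP[v _ ->]]; [exists x | exists v].
Qed.

Lemma openers_notin x : op x \notin [set op v | v in op x].
Proof.
by apply/imsetP=> -[v xv eq_op]; have := openers_self v; rewrite -eq_op xv.
Qed.

Lemma card_openers_set x : #|openers_set| = n.+1.
Proof.
rewrite (openers_setE x) cardsU1 openers_notin card_in_imset ?card_openers //.
exact: openers_opener_inj.
Qed.

(** The depth from x is a height of the set of openers from x, and heights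
    differ by constants; so the lowest arcs are those at depth 0. *)
Lemma low_openers x h y : is_height (op x) h ->
  [forall z, h y <= h z] = (op y == op x).
Proof.
move=> h_height.
have hE z : h z = depth x z + h x.
  by have := heights_shift x z h_height (depth_height x); rewrite depth_refl addn0.
apply/forallP/idP => [low_y|eq_op z]; rewrite -?depth_eq0.
  by have := low_y x; rewrite (hE y); lia.
by move: eq_op; rewrite -depth_eq0 => /eqP d0; rewrite (hE y) d0 (hE z); lia.
Qed.

Lemma colour_openers x : colour (op x) = odd x.
Proof.
have low := low_openers _ (bal_heightP (card_openers x)).
apply/existsP/idP => [[y]|odd_x]; last by exists x; rewrite low eqxx.
rewrite low => /andP[/eqP eq_op odd_y].
by have := nodd_openers x y; rewrite eq_op odd_y => /addnI; case: (odd x).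
Qed.

Lemma card_coloured_openers x :
  #|[set O in openers_set | colour O]| = nodd (op x) + odd x.
Proof.
rewrite (openers_setE x) addnC /nodd.
rewrite -(card_in_imset (f := op) (D := mem [set v in op x | odd v])); last first.
  move=> v w; rewrite in_set => /andP[xv _]; rewrite in_set => /andP[xw _].
  exact: (openers_opener_inj xv xw).
have -> : [set O in op x |: [set op v | v in op x] | colour O] =
   (if odd x then [set op x] else set0) :|: [set op v | v in [set v in op x | odd v]].
  apply/setP=> O; rewrite [LHS]in_set !in_setU in_set1 andb_orl; congr (_ || _).
    case: eqP => [->|neqO]; first by rewrite colour_openers; case: ifP; rewrite ?in_set1 ?eqxx ?in_set0.
    by case: ifP; rewrite ?in_set0 // in_set1; case: eqP.
  apply/andP/imsetP => [[/imsetP[v xv ->]]|[v]].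
    by rewrite colour_openers => odd_v; exists v; rewrite // in_set xv.
  by rewrite in_set => /andP[xv odd_v] ->; rewrite colour_openers imset_f.
have disj : op x \notin [set op v | v in [set v in op x | odd v]].
  apply: contra (openers_notin x) => /imsetP[v]; rewrite in_set => /andP[xv _] eq_op.
  by rewrite {1}eq_op imset_f.
by case: (odd x); rewrite ?set0U // cardsU1 disj.
Qed.

End OneMatching.

(** x is a lowest arc of its set of openers, and lowest arcs do not depend on
    the matching. *)
Lemma openers_move s x s' x' : ncmap s -> ncmap s' ->
  openers s x = openers s' x' -> openers s' x = openers s' x'.
Proof.
move=> ncs ncs' eqO; apply/eqP.
have h_height := depth_height ncs x.
rewrite -(low_openers ncs' (h := depth s x)) -?eqO //.
by rewrite (low_openers ncs _ h_height).
Qed.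

(** Suppose that an opener v, with partner w in s, is matched farther away by
    s'.  The chord of s' at w is then nested in that of s' at v, so its opener u
    lies between v and w; in s, the partner of u lies before w, so u is a
    counterexample for a shorter chord. *)
Lemma ncmap_le s s' x : ncmap s -> ncmap s' -> openers s x = openers s' x ->
  {in openers s x, forall v, pos x (s' v) <= pos x (s v)}.
Proof.
move=> ncs ncs' eqO v; have [sK s_neq s_nc] := ncs; have [sK' s'_neq s'_nc] := ncs'.
move: {2}(pos x (s v) - pos x v).+1 (ltnSn (pos x (s v) - pos x v)) => k.
elim: k v => // k IHk v le_k xv; rewrite leqNgt; apply/negP => lt_s.
set w := s v; set u := s' w.
have xv' : v \in openers s' x by rewrite -eqO.
have xw : w \notin openers s x by rewrite openers_mate ?xv.
have xu : u \in openers s x by rewrite eqO openers_mate -?eqO.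
have xu' : u \in openers s' x by rewrite -eqO.
have lt_vw : pos x v < pos x w by rewrite /w -openersP.
have lt_uw : pos x u < pos x w by have := xu'; rewrite openersP // /u sK'.
have neq_wv : w != v by rewrite eq_sym; exact: s_neq.
have neq_wv' : w != s' v by apply: contraTneq lt_s => <-; rewrite -leqNgt.
have := s'_nc w v neq_wv neq_wv'; rewrite !(inarc_opener ncs' _ xv') -/u -/w.
rewrite (ltnW lt_vw) lt_s /= => /esym/andP[le_vu _].
have neq_uv : u != v by apply: contra_neq neq_wv' => <-; rewrite /u sK'.
have lt_vu : pos x v < pos x u.
  by rewrite ltn_neqAle le_vu andbT (inj_eq (@pos_inj x)) eq_sym.
have neq_uw : u != w by rewrite eq_sym; exact: s'_neq.
have := s_nc u v neq_uv neq_uw; rewrite !(inarc_opener ncs _ xv) -/w.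
rewrite le_vu lt_uw /= => /esym/andP[_ lt_su].
have : pos x (s' u) <= pos x (s u) by apply: IHk => //; move: le_k; rewrite -/w; lia.
by rewrite [s' u]sK' leqNgt lt_su.
Qed.

(** By [ncmap_le] in both directions, an opener has the same partner in both
    matchings. *)
Lemma ncmap_unique s x s' x' : ncmap s -> ncmap s' ->
  openers s x = openers s' x' -> s =1 s'.
Proof.
move=> ncs ncs' eqO; have eqO' := openers_move ncs ncs' eqO.
have {x' eqO' eqO} eqO : openers s x = openers s' x by rewrite eqO'.
have eq_in v : v \in openers s x -> s v = s' v.
  move=> xv; apply: (@pos_inj x); apply/eqP; rewrite eqn_leq.
  by rewrite (ncmap_le ncs ncs') // (ncmap_le ncs' ncs) // -eqO.
have [sK _ _] := ncs; have [sK' _ _] := ncs'.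
move=> v; have [/eq_in//|nxv] := boolP (v \in openers s x).
have /eq_in : s v \in openers s x by rewrite openers_mate.
by rewrite sK => {2}->; rewrite sK'.
Qed.

Lemma opener_pred O h v : is_height O h -> v \in O -> h v = (h (ord_pred v)).+1.
Proof. by move=> hO Ov; have := hO (ord_pred v); rewrite ord_predK Ov. Qed.

Lemma closer_pred O h v : is_height O h -> v \notin O -> h (ord_pred v) = (h v).+1.
Proof. by move=> hO /negPf nOv; have := hO (ord_pred v); rewrite ord_predK nOv. Qed.

Lemma pos_pred x v w : pos x v < pos x w -> (pos x (ord_pred w)).+1 = pos x w.
Proof.
move=> lt_vw; have neq_zx : ord_pred w != x.
  apply: contraTneq lt_vw => <-; rewrite -leqNgt -{2}(ord_predK w).
  by rewrite pos_start.
by rewrite -(pos_ordS neq_zx) ord_predK.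
Qed.

(** * The matching of a balanced set *)

(** Parenthesis matching: cut the circle at a lowest arc x; each up step is
    matched with the first later step that goes below its height. *)
Section FirstReturn.
Variables (O : {set vertex n}) (h : vertex n -> nat) (x : vertex n).
Hypotheses (h_height : is_height O h) (x_low : forall y, h x <= h y) (cardO : #|O| = n).
Notation p := (pos x).

Definition first_return v : vertex n := [arg min_(w < x | (p v < p w) && (h w < h v)) p w].

Lemma returnP v : v \in O ->
  [/\ p v < p (first_return v), h v = (h (first_return v)).+1, first_return v \notin O
    & forall y, p v <= p y < p (first_return v) -> h v <= h y].
Proof.
move=> Ov; rewrite /first_return.
case: arg_minnP => [|w /andP[lt_vw lt_hwv] w_min].
  have lt_hxv : h x < h v by rewrite (opener_pred h_height Ov) ltnS.
  rewrite lt_hxv andbT ltn_neqAle pos_le_base andbT (inj_eq (@pos_inj x)).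
  by apply: contraTneq lt_hxv => ->; rewrite ltnn.
have above y : p v <= p y < p w -> h v <= h y.
  case/andP; rewrite leq_eqVlt => /orP[/eqP/pos_inj-> //|lt_vy lt_yw].
  by rewrite leqNgt; apply/negP => lt_h; have := w_min y; rewrite lt_vy lt_h => /(_ isT); lia.
have pw := pos_pred lt_vw.
have le_hz : h v <= h (ord_pred w) by apply: above; lia.
have nOw : w \notin O.
  by apply/negP => Ow; have := opener_pred h_height Ow; lia.
by split=> //; have := closer_pred h_height nOw; lia.
Qed.

Lemma return_inj : {in O &, injective first_return}.
Proof.
have wlog_lt v w : v \in O -> w \in O -> first_return v = first_return w -> p v < p w -> False.
  move=> Ov Ow eq_r lt_vw; have [lt_v hv _ above] := returnP Ov.
  have [lt_w hw _ _] := returnP Ow; have := above (ord_pred w).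
  by have := pos_pred lt_vw; have := opener_pred h_height Ow; rewrite eq_r in hv lt_v *; lia.
move=> v w Ov Ow eq_r; apply: (@pos_inj x); case: (ltngtP (p v) (p w)) => // lt_p.
  by case: (wlog_lt v w).
by case: (wlog_lt w v).
Qed.

(** Injectivity is enough, as there are n vertices on each side. *)
Lemma return_onto w : w \notin O -> exists2 v, v \in O & w = first_return v.
Proof.
move=> nOw; apply/imsetP; suff -> : first_return @: O = ~: O by rewrite inE.
apply/eqP; rewrite eqEcard; apply/andP; split.
  by apply/subsetP=> _ /imsetP[v Ov ->]; rewrite inE; case: (returnP Ov).
have := cardsC O; rewrite (card_in_imset return_inj) cardO card_ord; lia.
Qed.

Definition return_map v : vertex n :=
  if v \in O then first_return v else odflt v [pick u in O | first_return u == v].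

Lemma return_mapO v : v \in O -> return_map v = first_return v.
Proof. by rewrite /return_map => ->. Qed.

Lemma return_map_return v : v \in O -> return_map (first_return v) = v.
Proof.
move=> Ov; have [_ _ /negPf nOr _] := returnP Ov; rewrite /return_map nOr.
case: pickP => [u /andP[Ou /eqP/return_inj->] //|/(_ v)].
by rewrite Ov eqxx.
Qed.

Lemma return_mapK : involutive return_map.
Proof.
move=> v; have [Ov|/return_onto[u Ou ->]] := boolP (v \in O).
  by rewrite (return_mapO Ov) return_map_return.
by rewrite (return_map_return Ou) return_mapO.
Qed.

Lemma return_ncmap : ncmap return_map.
Proof.
have map_neq v : v != return_map v.
  have [Ov|/return_onto[u Ou ->]] := boolP (v \in O).
    by rewrite (return_mapO Ov); case: (returnP Ov) => _ _ + _; apply: contraNneq => <-.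
  by rewrite (return_map_return Ou); case: (returnP Ou) => _ _ + _; apply: contraNneq => ->.
split=> [||u v neq_uv neq_uv']; [exact: return_mapK | exact: map_neq |].
wlog Ov : v neq_uv neq_uv' / v \in O.
  move=> wlogO; have [|nOv] := boolP (v \in O); first exact: wlogO.
  have [w Ow def_v] := return_onto nOv.
  have sv : return_map v = w by rewrite def_v return_map_return.
  have sw : return_map w = v by rewrite -sv return_mapK.
  have neq_wv : w != v by rewrite -sv eq_sym.
  rewrite sv !(inarcC _ neq_wv); congr (~~ _).
  by rewrite -{1 2}sw; apply: wlogO; rewrite ?sw // -sv.
wlog Ou : u neq_uv neq_uv' / u \in O.
  move=> wlogO; have [|nOu] := boolP (u \in O); first exact: wlogO.
  have [w Ow def_u] := return_onto nOu.
  have su : return_map u = w by rewrite def_u return_map_return.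
  have sw : return_map w = u by rewrite -su return_mapK.
  rewrite su -{1}sw; symmetry; apply: wlogO => //.
    by apply: contra_neq neq_uv' => <-.
  by apply: contra_neq neq_uv => eq_w; rewrite -sw eq_w return_mapK.
have [lt_v hv nOfv above_v] := returnP Ov; have [lt_u hu nOfu above_u] := returnP Ou.
have neq_ret : first_return u != first_return v by apply: contra_neq neq_uv; exact: return_inj.
rewrite !return_mapO //; move: neq_uv neq_ret.
have neq_vfu : v != first_return u by apply: contraTneq Ov => ->.
move: neq_vfu; rewrite -!(inj_eq (@pos_inj x)) => neq_vfu neq_uv neq_ret.
have := above_v u; have := above_u v; have := above_v (first_return u); have := above_u (first_return v).
have neq_vr : v != first_return v by rewrite -(inj_eq (@pos_inj x)) neq_ltn lt_v.
rewrite !(inarc_pos x _ neq_vr).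
move=> *; apply/idP/idP; lia.
Qed.

Lemma openers_return : openers return_map x = O.
Proof.
apply/setP=> v; rewrite (openersP return_ncmap).
have [Ov|/return_onto[u Ou ->]] := boolP (v \in O).
  by rewrite return_mapO //; case: (returnP Ov).
by rewrite return_map_return //; case: (returnP Ou) => ltu _ _ _; rewrite ltnNge ltnW.
Qed.

End FirstReturn.

Lemma ncmap_exists O (x0 : vertex n) : #|O| = n ->
  exists s x, ncmap s /\ openers s x = O.
Proof.
move=> cardO; have h_height := bal_heightP cardO.
pose x := [arg min_(x < x0) bal_height O x].
have x_low y : bal_height O x <= bal_height O y.
  by rewrite /x; case: arg_minnP => // z _; apply.
exists (return_map O (bal_height O) x), x; split.
  exact: return_ncmap.
exact: openers_return.
Qed.

(** * Matchings and regions *)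

Definition edges (s : vertex n -> vertex n) : {set {set vertex n}} :=
  [set [set v; s v] | v : vertex n].

Definition mate (M : {set {set vertex n}}) v : vertex n :=
  odflt v [pick w | (w != v) && ([set v; w] \in M)].

Lemma edge_in_edges s v : [set v; s v] \in edges s.
Proof. exact: imset_f. Qed.

Lemma edgesP s e : involutive s -> e \in edges s ->
  forall v, v \in e -> e = [set v; s v].
Proof.
move=> sK /imsetP[w _ ->] v; rewrite in_set2 => /orP[]/eqP-> //.
by rewrite sK setUC.
Qed.

Lemma mate_edges s : involutive s -> (forall v, v != s v) -> mate (edges s) =1 s.
Proof.
move=> sK s_neq v; rewrite /mate; case: pickP => [w /andP[neq_wv vw_in]|/(_ (s v))].
  have := edgesP sK vw_in (set21 v w) => /setP/(_ w).
  by rewrite !in_set2 eqxx orbT (negPf neq_wv) => /esym/eqP.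
by rewrite eq_sym s_neq edge_in_edges.
Qed.

Lemma edges_matching s : involutive s -> (forall v, v != s v) ->
  perfect_matching (edges s).
Proof.
move=> sK s_neq; apply/andP; split; last first.
  by apply/forall_inP=> _ /imsetP[v _ ->]; rewrite cards2 s_neq.
apply/and3P; split.
- apply/eqP/setP=> v; rewrite in_setT; apply/bigcupP.
  by exists [set v; s v]; rewrite ?edge_in_edges ?set21.
- apply/trivIsetP=> e e' e_in e'_in; apply: contraR => /pred0Pn[v /andP[/= ve ve']].
  by rewrite (edgesP sK e_in ve) (edgesP sK e'_in ve').
- by apply/imsetP=> -[v _ /setP/(_ v)]; rewrite in_set0 set21.
Qed.

Lemma matching_mate M : perfect_matching M ->
  [/\ involutive (mate M), forall v, v != mate M v & edges (mate M) = M].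
Proof.
case/andP=> /and3P[/eqP coverM trivM _] /forall_inP card2.
have mateP v : v != mate M v /\ [set v; mate M v] \in M.
  have : v \in cover M by rewrite coverM.
  case/bigcupP=> e eM ve; rewrite /mate; case: pickP => [w /andP[neq_wv ->]|].
    by rewrite eq_sym.
  have /cards2P[a [b [neq_ab def_e]]] := card2 e eM.
  move: ve; rewrite def_e in_set2 => /orP[]/eqP->.
    by move/(_ b) => /=; rewrite eq_sym neq_ab -def_e eM.
  by move/(_ a) => /=; rewrite neq_ab setUC -def_e eM.
have edge_uniq e v : e \in M -> v \in e -> e = [set v; mate M v].
  move=> eM ve; apply/eqP; apply: contraT => neq_e.
  have := trivIsetP trivM e _ eM (proj2 (mateP v)) neq_e.
  by rewrite disjoint_sym => /disjointFr/(_ (set21 v _)); rewrite ve.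
split=> [v | v | ]; [| by case: (mateP v) |].
  have [_ vM] := mateP v; have := edge_uniq _ _ vM (set22 v _) => /setP/(_ v).
  rewrite set21 in_set2 => /esym/orP[]/eqP eq_v; last exact: esym.
  by have [/eqP] := mateP v.
apply/setP=> e; apply/imsetP/idP => [[v _ ->]|eM]; first by case: (mateP v).
have /cards2P[a [b [neq_ab def_e]]] := card2 e eM.
by exists a => //; apply: edge_uniq; rewrite ?def_e ?set21 // -def_e.
Qed.

Lemma edges_NCM s : ncmap s -> edges s \in NCM n.
Proof.
move=> [sK s_neq s_nc]; rewrite inE edges_matching //=.
apply/forall_inP=> e eM; apply/forall_inP=> e' e'M; apply/negP.
case/exists_inP=> a ae /exists_inP[b be' /exists_inP[c ce /exists_inP[d de']]].
case/and3P=> lt_ab lt_bc lt_cd.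
have def_c : c = s a.
  move: ce; rewrite (edgesP sK eM ae) in_set2 => /orP[]/eqP // eq_ca.
  by move: lt_ab lt_bc; rewrite eq_ca; lia.
have def_d : d = s b.
  move: de'; rewrite (edgesP sK e'M be') in_set2 => /orP[]/eqP // eq_db.
  by move: lt_bc lt_cd; rewrite eq_db; lia.
have := s_nc b a; rewrite -def_c -def_d /inarc !eq_ord_val; lia.
Qed.

Lemma NCM_ncmap M : M \in NCM n -> ncmap (mate M) /\ edges (mate M) = M.
Proof.
rewrite inE => /andP[/matching_mate[sK s_neq def_M] /forall_inP noX]; split=> //.
set s := mate M in sK s_neq def_M *; split=> // u v neq_uv neq_usv.
have cross (a b : vertex n) : a < b -> b < s a -> s a < s b -> False.
  move=> lt_ab lt_ba lt_sab.
  have eM c : [set c; s c] \in M by rewrite -def_M edge_in_edges.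
  have /forall_inP/(_ _ (eM b))/negP := noX _ (eM a); apply.
  apply/exists_inP; exists a; rewrite ?set21 //.
  apply/exists_inP; exists b; rewrite ?set21 //.
  apply/exists_inP; exists (s a); rewrite ?set22 //.
  apply/exists_inP; exists (s b); rewrite ?set22 //.
  by rewrite lt_ab lt_ba.
have := cross v u; have := cross (s v) u; have := cross v (s u); have := cross (s v) (s u).
have := cross u v; have := cross (s u) v; have := cross u (s v); have := cross (s u) (s v).
have := s_neq u; have := s_neq v; have neq_suv : s u != v.
  by rewrite (can2_eq sK sK).
have neq_susv : s u != s v by rewrite (inj_eq (inv_inj sK)).
move: neq_uv neq_usv neq_suv neq_susv.
rewrite !sK /inarc !neq_ord_val.
move: (nat_of_ord u) (nat_of_ord v) (nat_of_ord (s u)) (nat_of_ord (s v)) => a b c d.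
move=> *; lia.
Qed.

(** Seen from the last arc, the opener of a chord is its smaller end. *)
Lemma even_edges_openers s x : ncmap s ->
  (even_edges (edges s)).+1 = nodd (openers s x) + odd x.
Proof.
move=> ncs; have [sK s_neq _] := ncs.
have lt_last : (n.*2).-1 < n.*2 by have := ltn_ord x; lia.
pose l : vertex n := Ordinal lt_last.
have lE v : (v \in openers s l) = (v < s v).
  have pos_l w : pos l w = w.
    have l_val : l = (n.*2).-1 :> nat by [].
    by rewrite /pos; have := ltn_ord w; case: (ltnP l w); rewrite l_val; lia.
  by rewrite (openersP ncs) !pos_l.
rewrite (nodd_openers ncs x l) (_ : odd l) ?addn1; last first.
  by rewrite /= -subn1 oddB ?odd_double //; lia.
congr _.+1; rewrite /nodd -(card_in_imset (f := fun v => [set v; s v])).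
  congr #|pred_of_set _|; apply/setP=> e; rewrite in_set; apply/andP/imsetP.
    case=> e_in /exists_inP[i ie /exists_inP[j je /andP[lt_ij odd_i]]].
    have def_e := edgesP sK e_in ie; exists i => //.
    move: je; rewrite def_e in_set2 in_set lE => /orP[]/eqP eq_j.
      by move: lt_ij; rewrite eq_j ltnn.
    by rewrite -eq_j; move: lt_ij odd_i; rewrite /label /= negbK ltnS => -> ->.
  case=> v; rewrite in_set lE => /andP[lt_v odd_v] ->; split.
    exact: edge_in_edges.
  apply/exists_inP; exists v; rewrite ?set21 //.
  by apply/exists_inP; exists (s v); rewrite ?set22 // /label /= negbK ltnS lt_v odd_v.
move=> v w; rewrite in_set lE => /andP[lt_v _]; rewrite in_set lE => /andP[lt_w _].
move=> /setP/(_ w).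
rewrite set21 in_set2 => /orP[]/eqP // eq_w; move: lt_w lt_v.
by rewrite eq_w sK; lia.
Qed.

Definition region s x : {set vertex n} := [set y | openers s y == openers s x].

(** Two arcs are separated by a chord exactly when its opener changes. *)
Lemma regions_edges s : ncmap s -> regions (edges s) = [set region s x | x : vertex n].
Proof.
move=> [sK s_neq _]; rewrite /regions /equivalence_partition.
have sep v x y : separates [set v; s v] x y = (inarc v (s v) x != inarc v (s v) y).
  have inarcE (a b z : vertex n) : a < b -> inarc a b z = (a <= z < b) by rewrite /inarc; lia.
  have inarcE' (a b z : vertex n) : a < b -> inarc b a z = ~~ (a <= z < b) by rewrite /inarc; lia.
  apply/exists_inP/idP => [[a ae /exists_inP[b be /andP[lt_ab]]]|].
    rewrite -!inarcE //; move: ae be; rewrite !in_set2 => /orP[]/eqP eq_a /orP[]/eqP eq_b.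
    - by move: lt_ab; rewrite eq_a eq_b ltnn.
    - by rewrite eq_a eq_b.
    - by rewrite eq_a eq_b !(inarcC _ (s_neq v)) (inj_eq negb_inj).
    - by move: lt_ab; rewrite eq_a eq_b ltnn.
  have := s_neq v; rewrite neq_ord_val neq_ltn => /orP[] lt_v neq_in.
    exists v; rewrite ?set21 //; apply/exists_inP; exists (s v); rewrite ?set22 //.
    by rewrite lt_v -!inarcE.
  exists (s v); rewrite ?set22 //; apply/exists_inP; exists v; rewrite ?set21 //.
  by rewrite lt_v /= -(inj_eq negb_inj) -!inarcE'.
apply/setP=> A; apply/imsetP/imsetP => -[x _ ->]; exists x => //; apply/setP=> y;
  rewrite !in_set /=; [| symmetry];
  (apply/forall_inP/eqP => [noS|eq_op _ /imsetP[v _ ->]];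
    [apply/setP=> v; rewrite !inE; congr (~~ _); apply/esym/eqP; rewrite -[_ == _]negbK -sep;
     exact/noS/edge_in_edges
    |rewrite sep negbK; have /setP/(_ v) := eq_op; rewrite !inE => /negb_inj->; exact: eqxx]).
Qed.

(** * Rotations *)

Definition rotation (g : {perm vertex n}) : Prop :=
  (forall v w x, v != w -> inarc (g v) (g w) (g x) = inarc v w x)
  /\ (forall v, odd (g v) = odd v).

Lemma rotnE v : rotn n v = ordS (ordS v).
Proof. by rewrite permE. Qed.

Lemma rotn_rotation : rotation (rotn n).
Proof.
split=> [v w x neq_vw | v]; rewrite !rotnE; last by rewrite !odd_ordS negbK.
by rewrite !inarc_rotate // (inj_eq (@ordS_inj _)).
Qed.

Lemma expg_rotation g t : rotation g -> rotation (g ^+ t)%g.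
Proof.
case=> g_arc g_odd; split=> [v w x|v]; rewrite !permX.
  by elim: t => //= t IHt neq_vw; rewrite g_arc ?IHt // -!permX (inj_eq perm_inj).
by elim: t => //= t IHt; rewrite g_odd.
Qed.

Section Rotate.
Variable g : {perm vertex n}.
Hypothesis rot_g : rotation g.

Let g_arc v w x : v != w -> inarc (g v) (g w) (g x) = inarc v w x.
Proof. by case: rot_g => + _; apply. Qed.

Definition conj_map (s : vertex n -> vertex n) v := g (s ((g^-1)%g v)).

Lemma conj_mapE s v : conj_map s (g v) = g (s v).
Proof. by rewrite /conj_map permK. Qed.

Lemma conj_ncmap s : ncmap s -> ncmap (conj_map s).
Proof.
move=> [sK s_neq s_nc]; split=> [v | v | u v].
- by rewrite -(permKV g v) !conj_mapE sK.
- by rewrite -(permKV g v) conj_mapE (inj_eq perm_inj).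
- rewrite -(permKV g u) -(permKV g v) !conj_mapE !(inj_eq (@perm_inj _ g)) => neq_uv neq_usv.
  by rewrite !g_arc //; apply: s_nc.
Qed.

Lemma edges_conj s : edges (conj_map s) = [set g @: (e : {set vertex n}) | e in edges s].
Proof.
apply/setP=> e; apply/imsetP/imsetP => [[v _ ->]|[_ /imsetP[v _ ->] ->]].
  exists [set (g^-1)%g v; s ((g^-1)%g v)]; first exact: edge_in_edges.
  by rewrite imsetU1 imset_set1 permKV.
by exists (g v); rewrite // imsetU1 imset_set1 conj_mapE.
Qed.

Lemma openers_conj s x : ncmap s -> openers (conj_map s) (g x) = g @: openers s x.
Proof.
move=> [_ s_neq _]; apply/setP=> v; rewrite -(permKV g v) (mem_imset _ _ perm_inj).
by rewrite !inE conj_mapE g_arc.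
Qed.

Lemma region_conj s x : ncmap s -> region (conj_map s) (g x) = g @: region s x.
Proof.
move=> ncs; apply/setP=> y; rewrite -(permKV g y) (mem_imset _ _ perm_inj) !inE.
by rewrite !openers_conj // (inj_eq (imset_inj perm_inj)).
Qed.

Lemma regions_conj s : ncmap s ->
  regions (edges (conj_map s)) = [set g @: (c : {set vertex n}) | c in regions (edges s)].
Proof.
move=> ncs; rewrite !regions_edges //; last exact: conj_ncmap.
apply/setP=> c; apply/imsetP/imsetP => [[x _ ->]|[_ /imsetP[x _ ->] ->]].
  exists (region s ((g^-1)%g x)); first exact: imset_f.
  by rewrite -region_conj // permKV.
by exists (g x); rewrite // region_conj.
Qed.

Lemma nodd_rotate O : nodd (g @: O) = nodd O.
Proof.
rewrite /nodd -(card_imset (mem [set v in O | odd v]) (@perm_inj _ g)).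
congr #|pred_of_set _|; apply/setP=> v; rewrite -(permKV g v) !inE.
by rewrite !(mem_imset _ _ perm_inj) inE (proj2 rot_g).
Qed.

(** [even_edges] refers to the origin of the circle, but by
    [even_edges_openers] it can be read off from any arc. *)
Lemma even_edges_conj s (x : vertex n) : ncmap s ->
  even_edges (edges (conj_map s)) = even_edges (edges s).
Proof.
move=> ncs; apply: succn_inj; rewrite (even_edges_openers x ncs).
rewrite (even_edges_openers (g x) (conj_ncmap ncs)) openers_conj // nodd_rotate.
by rewrite (proj2 rot_g).
Qed.

End Rotate.

Lemma setact2E (M : {set {set vertex n}}) (g : {perm vertex n}) :
  ('P^*^*)%act M g = [set g @: (e : {set vertex n}) | e in M].
Proof. by apply: eq_imset => e; apply: eq_imset => v. Qed.

Lemma marked_act_NCMr k r (x : marked n) (g : {perm vertex n}) : 0 < n -> rotation g ->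
  x \in [set x in NCMr n r | even_edges x.1 == k] ->
  marked_act x g \in [set x in NCMr n r | even_edges x.1 == k].
Proof.
move=> n_gt0 rot_g; have v0 : vertex n by apply: (@Ordinal _ 0); lia.
case: x => M S /setIdP[]; rewrite [(M, S) \in NCMr n r]in_set => /and3P[/= M_in sub_S card_S] even_k.
have [ncs def_M] := NCM_ncmap M_in.
have gM : ('P^*^*)%act M g = edges (conj_map g (mate M)).
  by rewrite setact2E -{1}def_M edges_conj.
rewrite in_set /=; apply/andP; split; last first.
  by rewrite gM (even_edges_conj rot_g v0) ?def_M.
rewrite in_set /=; apply/and3P; split.
- by rewrite gM edges_NCM //; apply: conj_ncmap.
- rewrite gM regions_conj // def_M setact2E; exact: imsetS.
- by rewrite (card_setact _ S).
Qed.

End Circle.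

(** * Periodic sets of vertices *)

Lemma modnSml x d : (x %% d).+1 %% d = x.+1 %% d.
Proof. by rewrite -addn1 modnDml addn1. Qed.

Lemma val_rotnX n j (v : vertex n) :
  (rotn n ^+ j)%g v = (v + j.*2) %% n.*2 :> nat.
Proof.
rewrite permX; elim: j => [|j IHj] /=; first by rewrite addn0 modn_small.
by rewrite rotnE /= IHj doubleS !addnS modnSml -addn2 modnDml addn2.
Qed.

Section Lift.
Variables m t : nat.
Hypotheses (m_gt0 : 0 < m) (t_gt0 : 0 < t).
Notation n := (m * t).
Notation g := (rotn n ^+ t)%g.

Let t2_gt0 : 0 < t.*2. Proof. by rewrite double_gt0. Qed.

Definition reduce (v : vertex n) : vertex t := Ordinal (ltn_pmod v t2_gt0).

Lemma unroll_subproof (p : 'I_m * vertex t) : p.1 * t.*2 + p.2 < n.*2.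
Proof.
case: p => i v; rewrite doubleMr (@leq_trans (i.+1 * t.*2)) //=.
  by rewrite mulSn addnC ltn_add2r.
by rewrite leq_mul2r ltn_ord orbT.
Qed.

Definition unroll p : vertex n := Ordinal (unroll_subproof p).

Lemma reduce_unroll p : reduce (unroll p) = p.2.
Proof. by apply: val_inj; rewrite /= modnMDl modn_small. Qed.

Lemma unroll_surj v : exists i, v = unroll (i, reduce v).
Proof.
have lt_i : v %/ t.*2 < m by rewrite ltn_divLR // -doubleMr.
by exists (Ordinal lt_i); apply: val_inj; rewrite /= -divn_eq.
Qed.

Lemma unroll_inj : injective unroll.
Proof.
move=> p q eq_pq; have eq2 : p.2 = q.2 by rewrite -!reduce_unroll eq_pq.
case: p q eq2 eq_pq => [i v] [j w] /= <- /(congr1 val) /= /addIn/eqP.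
by rewrite eqn_pmul2r // => /eqP/val_inj->.
Qed.

Lemma reduce_ordS v : reduce (ordS v) = ordS (reduce v).
Proof.
apply: val_inj; rewrite /= modn_dvdm; last by rewrite doubleMr dvdn_mull.
by rewrite modnSml.
Qed.

Lemma odd_reduce v : odd (reduce v) = odd v.
Proof. by rewrite /= odd_mod // odd_double. Qed.

Lemma reduce_rotn v : reduce (g v) = reduce v.
Proof.
apply: val_inj; rewrite /= val_rotnX modn_dvdm ?modnDr //.
by rewrite doubleMr dvdn_mull.
Qed.

Definition unrolled (O : {set vertex t}) : {set vertex n} := reduce @^-1: O.

Lemma card_unrolled O : #|unrolled O| = m * #|O|.
Proof.
have -> : unrolled O = unroll @: setX [set: 'I_m] O.
  apply/setP=> v; rewrite inE; apply/idP/imsetP => [Ov|[p]].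
    by have [i def_v] := unroll_surj v; exists (i, reduce v); rewrite // !inE.
  by rewrite inE in_setT /= => Op ->; rewrite reduce_unroll.
by rewrite card_imset ?cardsX ?cardsT ?card_ord //; apply: unroll_inj.
Qed.

Lemma nodd_unrolled O : nodd (unrolled O) = m * nodd O.
Proof.
rewrite /nodd -card_unrolled; congr #|pred_of_set _|.
by apply/setP=> v; rewrite !inE odd_reduce.
Qed.

Lemma unrolled_inj : injective unrolled.
Proof.
move=> O O' /setP eqO; apply/setP=> v; have := eqO (unroll (Ordinal m_gt0, v)).
by rewrite !inE reduce_unroll.
Qed.

Lemma unrolled_fixedP (T : {set vertex n}) :
  reflect (exists O, T = unrolled O) (g @: T == T).
Proof.
apply: (iffP eqP) => [gT|[O ->]]; last first.
  apply/setP=> v; rewrite -{1}(permKV g v) (mem_imset _ _ perm_inj) !inE.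
  by rewrite -reduce_rotn permKV.
have gX j v : ((g ^+ j)%g v \in T) = (v \in T).
  rewrite permX; elim: j => //= j <-.
  by rewrite -{1}gT (mem_imset _ _ perm_inj).
exists [set v | unroll (Ordinal m_gt0, v) \in T]; apply/setP=> v; rewrite !inE.
have [i def_v] := unroll_surj v; rewrite -(gX i (unroll _)); congr (_ \in T).
apply: ord_inj; rewrite -expgM val_rotnX /= mul0n add0n.
rewrite {1}def_v /= (doubleMl t) [t.*2 * i]mulnC [_ %% _ + _]addnC.
by rewrite [RHS]modn_small //; apply: (unroll_subproof (i, reduce v)).
Qed.

Lemma card_fixed_sets (P : pred {set vertex n}) (P' : pred {set vertex t}) :
  (forall O : {set vertex t}, P (unrolled O) = P' O) ->
  #|[set T : {set vertex n} | (g @: T == T) && P T]| = #|[set O : {set vertex t} | P' O]|.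
Proof.
move=> eqPP'; rewrite -(card_imset _ unrolled_inj).
congr #|pred_of_set _|; apply/setP=> T; rewrite inE.
apply/andP/imsetP => [[/unrolled_fixedP[O ->] PO]|[O]].
  by exists O; rewrite // inE -eqPP'.
by rewrite inE -eqPP' => PO ->; split=> //; apply/unrolled_fixedP; exists O.
Qed.

(** A height of O composed with the reduction is a height of its periodic
    extension, so lowest arcs reduce to lowest arcs; and reduction modulo 2t
    keeps parity. *)
Lemma colour_unrolled (O : {set vertex t}) : #|O| = t -> colour (unrolled O) = colour O.
Proof.
move=> cardO.
have [s' [x' [ncs' O'E]]] := ncmap_exists (Ordinal t2_gt0) cardO.
have n2_gt0 : 0 < n.*2 by rewrite double_gt0 muln_gt0 m_gt0.
have [|s [x [ncs OE]]] := @ncmap_exists n (unrolled O) (Ordinal n2_gt0).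
  by rewrite card_unrolled cardO.
have h_height : is_height (openers s x) (fun v => bal_height O (reduce v)).
  move=> y; rewrite OE inE reduce_ordS; exact: bal_heightP.
rewrite -OE colour_openers //.
have := low_openers ncs x h_height; rewrite eqxx => /forallP low_x.
have h'_height : is_height (openers s' x') (bal_height O).
  by rewrite O'E; apply: bal_heightP.
have /eqP eqO : openers s' (reduce x) == openers s' x'.
  rewrite -(low_openers ncs' _ h'_height); apply/forallP=> z.
  by have := low_x (unroll (Ordinal m_gt0, z)); rewrite reduce_unroll.
by rewrite -O'E -eqO colour_openers // odd_reduce.
Qed.

End Lift.

(** * Counting matchings by their even edges *)

Section Counting.
Variable n : nat.
Hypothesis n_gt0 : 0 < n.
Implicit Types (O : {set vertex n}) (M : {set {set vertex n}}).

Let v0 : vertex n.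
Proof. by apply: (@Ordinal _ 0); rewrite double_gt0. Qed.

Lemma eq_openers (s s' : vertex n -> vertex n) x : s =1 s' -> openers s x = openers s' x.
Proof. by move=> eq_s; apply/setP=> v; rewrite !inE eq_s. Qed.

Lemma eq_edges (s s' : vertex n -> vertex n) : s =1 s' -> edges s = edges s'.
Proof. by move=> eq_s; apply: eq_imset => v; rewrite eq_s. Qed.

Notation ops M := (openers_set (mate M)).

Lemma ops_uniq M M' O : M \in NCM n -> M' \in NCM n ->
  O \in ops M -> O \in ops M' -> M = M'.
Proof.
move=> /NCM_ncmap[ncs <-] /NCM_ncmap[ncs' <-] /imsetP[x _ ->] /imsetP[x' _ eqO].
move: eqO; rewrite !(eq_openers _ (mate_edges _ _)); try by [case: ncs | case: ncs'].
by move=> eqO; apply: eq_edges; apply: ncmap_unique eqO.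
Qed.

Lemma ops_exist O : #|O| = n -> exists2 M, M \in NCM n & O \in ops M.
Proof.
move=> cardO; have [s [x [ncs <-]]] := ncmap_exists v0 cardO.
exists (edges s); first exact: edges_NCM.
have [sK s_neq _] := ncs.
by apply/imsetP; exists x; rewrite // (eq_openers _ (mate_edges sK s_neq)).
Qed.

Lemma ops_card M O : M \in NCM n -> O \in ops M -> #|O| = n.
Proof. by move=> /NCM_ncmap[ncs _] /imsetP[x _ ->]; apply: card_openers. Qed.

(** Balanced sets are classified by the matching they come from. *)
Lemma card_by_matching (P : pred {set vertex n}) :
  #|[set O : {set vertex n} | (#|O| == n) && P O]|
    = \sum_(M in NCM n) #|[set O in ops M | P O]|.
Proof.
pose phi O := odflt set0 [pick M in NCM n | O \in ops M].
have phiP O : #|O| = n -> (phi O \in NCM n) && (O \in ops (phi O)).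
  move=> cardO; rewrite /phi; case: pickP => //= noM.
  by have [M M_in OM] := ops_exist cardO; have := noM M; rewrite M_in OM.
rewrite -sum1_card (partition_big phi (mem (NCM n))) /=; last first.
  by move=> O; rewrite inE => /andP[/eqP/phiP/andP[]].
apply: eq_bigr => M M_in; rewrite -sum1_card; apply: eq_bigl => O.
rewrite !in_set; apply/idP/idP => [/andP[/andP[/eqP/phiP/andP[_ OM] PO] /eqP<-]|].
  by rewrite OM.
move=> /andP[OM PO]; have cardO := ops_card M_in OM; rewrite cardO eqxx PO /=.
have /andP[phi_in Ophi] := phiP O cardO.
by apply/eqP; apply: ops_uniq Ophi OM.
Qed.

Definition narayana k := #|[set M in NCM n | even_edges M == k]|.

Lemma nodd_ops M O : M \in NCM n -> O \in ops M ->
  nodd O + colour O = (even_edges M).+1.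
Proof.
move=> /NCM_ncmap[ncs def_M] /imsetP[x _ ->].
by rewrite colour_openers // -(even_edges_openers x ncs) def_M.
Qed.

Lemma card_ops_coloured M : M \in NCM n ->
  #|[set O in ops M | colour O]| = (even_edges M).+1.
Proof.
move=> M_in; have [ncs def_M] := NCM_ncmap M_in.
by rewrite (card_coloured_openers ncs v0) -(even_edges_openers v0 ncs) def_M.
Qed.

Lemma card_ops_uncoloured M : M \in NCM n ->
  #|[set O in ops M | ~~ colour O]| = n - even_edges M.
Proof.
move=> M_in; have [ncs def_M] := NCM_ncmap M_in.
have := card_openers_set ncs v0; rewrite -(cardsID [set O | colour O] (ops M)).
have -> : ops M :&: [set O | colour O] = [set O in ops M | colour O].
  by apply/setP=> O; rewrite in_setI !in_set.
have -> : ops M :\: [set O | colour O] = [set O in ops M | ~~ colour O].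
  by apply/setP=> O; rewrite in_setD !in_set andbC.
by rewrite card_ops_coloured //; lia.
Qed.

Lemma count_coloured k :
  #|[set O : {set vertex n} | (#|O| == n) && (colour O && (nodd O == k))]|
    = k.+1 * narayana k.
Proof.
rewrite card_by_matching /narayana mulnC -sum_nat_const.
rewrite [RHS](eq_bigl (fun M => (M \in NCM n) && (even_edges M == k))); last by move=> M; rewrite [LHS]in_set.
rewrite big_mkcondr; apply: eq_bigr => M M_in; case: eqP => [<-|neq_k].
  rewrite -card_ops_coloured //; congr #|pred_of_set _|; apply/setP=> O.
  rewrite !in_set; case OM: (O \in ops M) => //=.
  have := nodd_ops M_in OM; case: (colour O) => //=.
  by rewrite addn1 => -[->]; rewrite eqxx.
apply: eq_card0 => O; rewrite in_set; apply/negP=> /and3P[OM col_O /eqP nodd_O].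
by have := nodd_ops M_in OM; rewrite col_O; lia.
Qed.

Lemma count_uncoloured k :
  #|[set O : {set vertex n} | (#|O| == n) && (~~ colour O && (nodd O == k.+1))]|
    = (n - k) * narayana k.
Proof.
rewrite card_by_matching /narayana mulnC -sum_nat_const.
rewrite [RHS](eq_bigl (fun M => (M \in NCM n) && (even_edges M == k))); last by move=> M; rewrite [LHS]in_set.
rewrite big_mkcondr; apply: eq_bigr => M M_in; case: eqP => [<-|neq_k].
  rewrite -card_ops_uncoloured //; congr #|pred_of_set _|; apply/setP=> O.
  rewrite !in_set; case OM: (O \in ops M) => //=.
  have := nodd_ops M_in OM; case: (colour O) => //=.
  by rewrite addn0 => ->; rewrite eqxx.
apply: eq_card0 => O; rewrite in_set; apply/negP=> /and3P[OM col_O /eqP nodd_O].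
by have := nodd_ops M_in OM; rewrite (negPf col_O); lia.
Qed.

Lemma count_uncoloured0 :
  #|[set O : {set vertex n} | (#|O| == n) && (~~ colour O && (nodd O == 0))]| = 0.
Proof.
rewrite card_by_matching big1 // => M M_in.
apply: eq_card0 => O; rewrite in_set; apply/negP=> /and3P[OM col_O /eqP nodd_O].
by have := nodd_ops M_in OM; rewrite (negPf col_O) nodd_O.
Qed.

Definition odds : {set vertex n} := [set v : vertex n | odd v].

Lemma card_odds : #|odds| = n /\ #|~: odds| = n.
Proof.
have eq_card : #|odds| = #|~: odds|.
  rewrite -(card_imset (mem odds) (@ordS_inj _)); congr #|pred_of_set _|.
  apply/setP=> v; rewrite -(ord_predK v) (mem_imset _ _ (@ordS_inj _)).
  by rewrite !inE odd_ordS negbK.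
have := cardsC odds; rewrite card_ord -eq_card addnn => /double_inj->.
by [].
Qed.

(** Half of the vertices are odd; choose k odd ones, and n - k even ones. *)
Lemma count_nodd k : k <= n ->
  #|[set O : {set vertex n} | (#|O| == n) && (nodd O == k)]| = 'C(n, k) * 'C(n, k).
Proof.
move=> lekn; have [card_o card_e] := card_odds.
pose draws (B : {set vertex n}) j := [set A : {set vertex n} | (A \subset B) && (#|A| == j)].
have drawsE B j A : (A \in draws B j) = (A \subset B) && (#|A| == j) by rewrite in_set.
have -> : 'C(n, k) * 'C(n, k) = #|setX (draws odds k) (draws (~: odds) (n - k))|.
  by rewrite cardsX !cards_draws card_o card_e bin_sub.
(* A set is recovered from its odd and even parts. *)
have trace (A B : {set vertex n}) : A \subset odds -> B \subset ~: odds ->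
    (A :|: B) :&: odds = A /\ (A :|: B) :\: odds = B.
  rewrite -disjoints_subset => Ao Bo; rewrite setIUl setDUl (setIidPl Ao).
  have /eqP-> : A :\: odds == set0 by rewrite setD_eq0.
  by rewrite (setDidPl Bo) (disjoint_setI0 Bo) setU0 set0U.
rewrite -(card_in_imset (f := fun p : {set vertex n} * {set vertex n} => p.1 :|: p.2)).
  congr #|pred_of_set _|; apply/setP=> O; rewrite in_set; apply/andP/imsetP.
    move=> [/eqP cardO /eqP nodd_O]; exists (O :&: odds, O :\: odds); last by rewrite setID.
    have cardOo : #|O :&: odds| = k.
      by rewrite -nodd_O /nodd; congr #|pred_of_set _|; apply/setP=> v; rewrite !inE.
    rewrite in_setX !drawsE subsetIr cardOo eqxx /= setDE subsetIr -setDE /=.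
    rewrite -(eqn_add2l k) subnKC //; apply/eqP.
    by have := cardsID odds O; rewrite cardO cardOo.
  case=> -[A B]; rewrite in_setX !drawsE /=.
  case/andP=> /andP[Ao /eqP cardA] /andP[Bo /eqP cardB] ->.
  have [traceA traceB] := trace A B Ao Bo; split.
    by rewrite -(cardsID odds) traceA traceB cardA cardB subnKC.
  rewrite /nodd -cardA -{2}traceA; apply/eqP; congr #|pred_of_set _|.
  by apply/setP=> v; rewrite !inE.
move=> [A B] [A' B']; rewrite !in_setX !drawsE /=.
move=> /andP[/andP[Ao _] /andP[Bo _]] /andP[/andP[Ao' _] /andP[Bo' _]] eqU.
have [traceA traceB] := trace A B Ao Bo; have [traceA' traceB'] := trace A' B' Ao' Bo'.
by congr pair; [rewrite -traceA eqU | rewrite -traceB eqU].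
Qed.

(** Counting balanced sets by colour gives the recursion
    'C(n, j)^2 = (j + 1) N_j + (n - j + 1) N_(j-1), and the two values below
    determine each other. *)
Lemma narayana_count k :
  k.+1 * narayana k = 'C(n, k) * 'C(n.-1, k) /\
  (n - k) * narayana k = 'C(n, k.+1) * 'C(n.-1, k).
Proof.
have split_colour j : j <= n -> 'C(n, j) * 'C(n, j) =
    j.+1 * narayana j + (if j is i.+1 then (n - i) * narayana i else 0).
  move=> lejn; rewrite -count_nodd // -count_coloured.
  rewrite -(cardsID [set O | colour O]); congr (_ + _).
    by congr #|pred_of_set _|; apply/setP=> O; rewrite !inE -andbA [_ && colour _]andbC.
  have -> : [set O : {set vertex n} | (#|O| == n) && (nodd O == j)] :\: [set O | colour O]
      = [set O : {set vertex n} | (#|O| == n) && (~~ colour O && (nodd O == j))].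
    by apply/setP=> O; rewrite !inE andbCA.
  by case: j lejn => [|j] _; [exact: count_uncoloured0 | exact: count_uncoloured].
have second j : j.+1 * narayana j = 'C(n, j) * 'C(n.-1, j) ->
    (n - j) * narayana j = 'C(n, j.+1) * 'C(n.-1, j).
  move=> def_j; apply/eqP; rewrite -(eqn_pmul2l (ltn0Sn j)) mulnCA def_j.
  by rewrite !mulnA -mul_bin_left -!mulnA.
suff first : k.+1 * narayana k = 'C(n, k) * 'C(n.-1, k) by split=> //; exact: second.
have [lekn|ltnk] := leqP k n; last first.
  rewrite bin_small // mul0n /narayana; apply/eqP; rewrite muln_eq0 /= cards_eq0.
  apply/eqP/setP=> M; rewrite in_set0 inE; apply/negP=> /andP[M_in /eqP even_k].
  have [ncs def_M] := NCM_ncmap M_in; have := even_edges_openers v0 ncs.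
  rewrite def_M even_k => def_k; have := subset_leq_card (subsetIl (openers (mate M) v0) odds).
  rewrite card_openers // (_ : _ :&: odds = [set v in openers (mate M) v0 | odd v]).
    rewrite -/(nodd _); case: (odd v0) def_k; lia.
  by apply/setP=> v; rewrite !inE.
elim: k lekn => [|k IHk] lekn.
  by have := split_colour 0 lekn; rewrite !bin0 addn0.
have := split_colour k.+1 lekn; rewrite (second _ (IHk (ltnW lekn))).
have -> : 'C(n, k.+1) = 'C(n.-1, k.+1) + 'C(n.-1, k) by rewrite -{1}(prednK n_gt0) binS.
nia.
Qed.

End Counting.

(** * Matchings and marks fixed by a rotation *)

Lemma setact1E n (O : {set vertex n}) (g : {perm vertex n}) : ('P^*)%act O g = g @: O.
Proof. by apply: eq_imset => v. Qed.

Lemma order_rotn n : 0 < n -> #[rotn n]%g = n.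
Proof.
move=> n_gt0; apply/eqP; rewrite eqn_dvd; apply/andP; split.
  rewrite order_dvdn; apply/eqP/permP=> v; apply: ord_inj.
  by rewrite val_rotnX perm1 modnDr modn_small.
have v0 : vertex n by apply: (@Ordinal _ 0); rewrite double_gt0.
have := congr1 (fun p : {perm vertex n} => p v0 : nat) (expg_order (rotn n)).
rewrite val_rotnX perm1 => /eqP; rewrite -{2}(modn_small (ltn_ord v0)).
by rewrite -{2}[v0 : nat]addn0 eqn_modDl mod0n -/(dvdn _ _) -!muln2 dvdn_pmul2r.
Qed.

Section FixedMatchings.
Variables (n : nat) (g : {perm vertex n}).
Hypotheses (n_gt0 : 0 < n) (rot_g : rotation g).
Implicit Types (O : {set vertex n}) (M : {set {set vertex n}}).
Notation ops M := (openers_set (mate M)).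
Notation "M ^g" := (('P^*^*)%act M g) (at level 2, format "M ^g").

Let v0 : vertex n.
Proof. by apply: (@Ordinal _ 0); rewrite double_gt0. Qed.

Lemma matching_rotate M : M \in NCM n -> M^g = edges (conj_map g (mate M)).
Proof.
by move=> /NCM_ncmap[_ def_M]; rewrite setact2E -{1}def_M edges_conj.
Qed.

Lemma NCM_rotate M : M \in NCM n -> M^g \in NCM n.
Proof.
move=> M_in; have [ncs _] := NCM_ncmap M_in.
by rewrite matching_rotate // edges_NCM //; apply: conj_ncmap.
Qed.

Lemma mate_rotate M : M \in NCM n -> mate M^g =1 conj_map g (mate M).
Proof.
move=> M_in; have [ncs _] := NCM_ncmap M_in; rewrite matching_rotate //.
by have [sK s_neq _] := conj_ncmap rot_g ncs; apply: mate_edges.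
Qed.

Lemma openers_rotate M x : M \in NCM n ->
  openers (mate M^g) (g x) = g @: openers (mate M) x.
Proof.
move=> M_in; have [ncs _] := NCM_ncmap M_in.
by rewrite (eq_openers _ (mate_rotate M_in)) openers_conj.
Qed.

Lemma ops_fixed M O : M \in NCM n -> O \in ops M -> g @: O = O -> M^g = M.
Proof.
move=> M_in OM gO; have M_in' := NCM_rotate M_in.
apply: (ops_uniq M_in' M_in _ OM); rewrite -gO; have /imsetP[x _ ->] := OM.
by rewrite -openers_rotate //; apply: imset_f.
Qed.

Lemma openers_fixed M x : M \in NCM n -> M^g = M ->
  openers (mate M) (g x) = g @: openers (mate M) x.
Proof. by move=> M_in gM; rewrite -openers_rotate // gM. Qed.

Lemma ops_rotate M O : M \in NCM n -> M^g = M -> O \in ops M -> g @: O \in ops M.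
Proof.
by move=> M_in gM /imsetP[x _ ->]; rewrite -openers_fixed //; apply: imset_f.
Qed.

(** If there were two regions, the second would be the inner region of an opener
    v of the first; its rotation is itself, so g v = v. *)
Lemma fixed_ops_uniq M O O' : (forall v, g v != v) -> M \in NCM n -> M^g = M ->
  O \in ops M -> O' \in ops M -> g @: O = O -> g @: O' = O' -> O = O'.
Proof.
move=> g_free M_in gM /imsetP[x _ ->] /imsetP[y _ ->] gO gO'.
have [ncs _] := NCM_ncmap M_in.
have [//|[v xv eq_yv]] := openers_cover ncs x y.
have xgv : g v \in openers (mate M) x by rewrite -gO mem_imset //; apply: perm_inj.
have := openers_opener_inj ncs xgv xv; rewrite openers_fixed // -eq_yv gO' => /(_ erefl).
by move/eqP; rewrite (negPf (g_free v)).
Qed.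

(** The n + 1 regions are permuted by a p-group, and p divides n. *)
Lemma fixed_ops_prime M p : prime p -> (p.-group <[g]>)%g -> p %| n ->
  M \in NCM n -> M^g = M -> exists2 O, O \in ops M & g @: O = O.
Proof.
move=> p_pr pG p_dvd_n M_in gM; have [ncs _] := NCM_ncmap M_in.
have acts_g : [acts <[g]>, on ops M | 'P^*]%g.
  rewrite /acts_on cycle_subG !inE; apply/subsetP=> O OM; rewrite inE /=.
  by rewrite setact1E ops_rotate.
have := pgroup_fix_mod pG acts_g; rewrite (card_openers_set ncs v0).
have [->|[O]] := set_0Vmem ('Fix_(ops M | 'P^*)(<[g]>))%g.
  rewrite cards0 mod0n => /eqP; rewrite -/(dvdn _ _) -addn1 dvdn_addr // dvdn1.
  by move/eqP=> p1; rewrite p1 in p_pr.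
rewrite inE afix_cycle => /andP[OM /afix1P] /=; rewrite setact1E => gO _.
by exists O.
Qed.

Section Marks.
Variables (M : {set {set vertex n}}) (x : vertex n).
Hypotheses (M_in : M \in NCM n) (gM : M^g = M).
Notation A := (openers (mate M) x).
Hypothesis gA : g @: A = A.
Notation rho := (region (mate M)).

Let ncs : ncmap (mate M). Proof. by case: (NCM_ncmap M_in). Qed.

Lemma region_eq y z : (rho y == rho z) = (openers (mate M) y == openers (mate M) z).
Proof.
apply/eqP/eqP => [/setP/(_ y)|eq_op]; first by rewrite !inE eqxx => /esym/eqP.
by apply/setP=> w; rewrite !inE eq_op.
Qed.

Lemma region_fixed y : rho (g y) = g @: rho y.
Proof.
rewrite -region_conj //; apply/setP=> w; rewrite !inE.
by rewrite -!(eq_openers _ (mate_rotate M_in)) gM.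
Qed.

Lemma region_opener_inj : {in A &, injective rho}.
Proof.
move=> v w Av Aw /eqP; rewrite region_eq => /eqP; exact: (openers_opener_inj ncs Av Aw).
Qed.

Lemma region_base_notin (T : {set vertex n}) : T \subset A -> rho x \notin rho @: T.
Proof.
move=> /subsetP subTA; apply/imsetP=> -[v /subTA Av /eqP].
rewrite region_eq => /eqP eq_op; have := openers_self ncs v.
by rewrite -eq_op Av.
Qed.

Lemma regions_split : regions M = rho x |: rho @: A.
Proof.
have [_ {1}<-] := NCM_ncmap M_in; rewrite regions_edges //.
apply/setP=> c; rewrite in_setU1; apply/imsetP/orP => [[y _ ->]|].
  have [eq_op|[v Av eq_op]] := openers_cover ncs x y; [left | right].
    by rewrite region_eq eq_op.
  by have /eqP-> : rho y == rho v; [rewrite region_eq eq_op | exact: imset_f].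
by case=> [/eqP->|/imsetP[v _ ->]]; [exists x | exists v].
Qed.

(** A set of regions is a choice whether to take the base region and a set of
    openers, which stand for the inner regions of their chords. *)
Definition push (b : bool) (T : {set vertex n}) : {set {set vertex n}} :=
  if b then rho x |: rho @: T else rho @: T.

Definition pull (S : {set {set vertex n}}) := [set v in A | rho v \in S].

Lemma base_in_push b (T : {set vertex n}) : T \subset A -> (rho x \in push b T) = b.
Proof.
by move=> subTA; case: b; rewrite /push ?setU11 // (negPf (region_base_notin subTA)).
Qed.

Lemma pull_push b (T : {set vertex n}) : T \subset A -> pull (push b T) = T.
Proof.
move=> subTA; apply/setP=> v; rewrite in_set; apply/andP/idP => [[Av]|Tv].
  have neq_v : rho v != rho x.
    by apply: contraTneq (imset_f rho Av) => ->; apply: region_base_notin.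
  have : rho v \in rho @: T -> v \in T.
    move=> /imsetP[w Tw] /region_opener_inj -> //.
    exact: (subsetP subTA).
  by case: b => inT; rewrite /push ?in_setU1 ?(negPf neq_v).
have Av := subsetP subTA v Tv.
by split=> //; case: b; rewrite /push ?in_setU1 imset_f ?orbT.
Qed.

Lemma push_pull (S : {set {set vertex n}}) :
  S \subset regions M -> push (rho x \in S) (pull S) = S.
Proof.
rewrite regions_split => /subsetP subS; apply/setP=> c.
have imP : (c \in rho @: pull S) = (c \in S) && (c != rho x).
  apply/imsetP/andP => [[v]|[Sc neq_c]].
    rewrite in_set => /andP[Av Sv] ->; split=> //.
    by apply: contraTneq (imset_f rho Av) => ->; apply: region_base_notin.
  have := subS c Sc; rewrite in_setU1 (negPf neq_c) => /imsetP[v Av def_c].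
  by exists v; rewrite // in_set Av -def_c.
rewrite /push; case: ifP => Sx; rewrite ?in_setU1 imP; case: eqP => [->|] //=.
  by rewrite andbT.
  by rewrite Sx.
by rewrite andbT.
Qed.

Lemma card_push b (T : {set vertex n}) : T \subset A -> #|push b T| = b + #|T|.
Proof.
move=> subTA; have card_im : #|rho @: T| = #|T|.
  by apply: card_in_imset; apply: sub_in2 region_opener_inj; apply/subsetP.
by case: b; rewrite /push ?cardsU1 ?region_base_notin // card_im.
Qed.

Lemma rotate_push b (T : {set vertex n}) : (push b T)^g = push b (g @: T).
Proof.
have gx : g @: rho x = rho x.
  by rewrite -region_fixed; apply/eqP; rewrite region_eq openers_fixed // gA.
have gT : [set g @: (c : {set vertex n}) | c in rho @: T] = rho @: (g @: T).
  rewrite -!imset_comp; apply: eq_imset => v /=; exact/esym/region_fixed.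
by rewrite setact2E; case: b; rewrite /push ?imsetU1 gT ?gx.
Qed.

Lemma push_regions b (T : {set vertex n}) : T \subset A -> push b T \subset regions M.
Proof.
move=> subTA; rewrite regions_split /push; have := imsetS rho subTA.
by case: b => sub; rewrite ?setUS // (subset_trans sub) ?subsetUr.
Qed.

Lemma count_marks_base b r :
  #|[set S : {set {set vertex n}} |
      [&& S \subset regions M, #|S| == r & S^g == S] && ((rho x \in S) == b)]|
  = #|[set T : {set vertex n} | (g @: T == T) && ((T \subset A) && (b + #|T| == r))]|.
Proof.
rewrite -(card_in_imset (f := push b)).
  congr #|pred_of_set _|; apply/setP=> S; rewrite in_set; apply/andP/imsetP.
    case=> /and3P[subS /eqP cardS /eqP gS] /eqP def_b.
    have defS := push_pull subS; rewrite def_b in defS.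
    have subT : pull S \subset A by apply/subsetP=> v; rewrite in_set => /andP[].
    exists (pull S); rewrite // in_set subT -card_push // defS cardS eqxx andbT.
    have subgT : g @: pull S \subset A by rewrite -gA; apply: imsetS.
    by rewrite -(pull_push b subgT) -rotate_push defS gS eqxx.
  case=> T; rewrite in_set => /and3P[/eqP gT subT cardT] ->.
  by rewrite base_in_push // push_regions // card_push // cardT rotate_push gT !eqxx.
move=> T T'; rewrite !in_set => /and3P[_ subT _] /and3P[_ subT' _] eq_push.
by rewrite -(pull_push b subT) eq_push pull_push.
Qed.

Lemma count_marks r :
  #|[set S : {set {set vertex n}} | [&& S \subset regions M, #|S| == r & S^g == S]]|
  = #|[set T : {set vertex n} | (g @: T == T) && ((T \subset A) && (#|T| == r))]|
    + #|[set T : {set vertex n} | (g @: T == T) && ((T \subset A) && (#|T|.+1 == r))]|.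
Proof.
rewrite -(count_marks_base false) -(count_marks_base true) addnC.
rewrite -(cardsID [set S : {set {set vertex n}} | rho x \in S]).
by congr (_ + _); congr #|pred_of_set _|; apply/setP=> S;
  rewrite ?in_setI ?in_setD !in_set ?eqb_id // andbC eqbF_neg.
Qed.

End Marks.
End FixedMatchings.

Lemma rotn_free n j (v : vertex n) : ~~ (n %| j) -> (rotn n ^+ j)%g v != v.
Proof.
apply: contra => /eqP/(congr1 (fun w : vertex n => w : nat)) /eqP.
rewrite val_rotnX -{2}(modn_small (ltn_ord v)) -{2}[v : nat]addn0 eqn_modDl mod0n.
by rewrite -/(dvdn _ _) -!muln2 dvdn_pmul2r.
Qed.

Definition fixed_NCM n (g : {perm vertex n}) k :=
  [set M in NCM n | (('P^*^*)%act M g == M) && (even_edges M == k)].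

Section Divisor.
Variables m t : nat.
Hypotheses (m_gt0 : 0 < m) (t_gt0 : 0 < t).
Notation n := (m * t).
Notation g := (rotn n ^+ t)%g.

Let n_gt0 : 0 < n. Proof. by rewrite muln_gt0 m_gt0. Qed.
Let rot_g : rotation g. Proof. exact/expg_rotation/rotn_rotation. Qed.

Lemma count_scaled_subsets (A : {set vertex t}) j : #|A| = t ->
  #|[set T : {set vertex t} | (T \subset A) && (m * #|T| == j)]|
    = (m %| j) * 'C(t, j %/ m).
Proof.
move=> cardA; case dvd_j: (m %| j); last first.
  apply: eq_card0 => T; rewrite inE; apply/negP=> /andP[_ /eqP def_j].
  by rewrite -def_j dvdn_mulr in dvd_j.
rewrite mul1n -[in RHS]cardA -cards_draws; congr #|pred_of_set _|.
apply/setP=> T; rewrite !in_set; congr (_ && _).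
by rewrite -[RHS](eqn_pmul2l m_gt0) [m * (_ %/ _)]mulnC divnK.
Qed.

Lemma count_fixed_marks M (x : vertex n) (r : nat) : M \in NCM n -> ('P^*^*)%act M g = M ->
  g @: openers (mate M) x = openers (mate M) x ->
  #|[set S : {set {set vertex n}} |
      [&& S \subset regions M, #|S| == r & ('P^*^*)%act S g == S]]|
  = (m %| r) * 'C(t, r %/ m) + (0 < r) * ((m %| r.-1) * 'C(t, r.-1 %/ m)).
Proof.
move=> M_in gM gA; have [ncs _] := NCM_ncmap M_in.
rewrite (count_marks rot_g M_in gM gA).
have /eqP/(unrolled_fixedP m_gt0 t_gt0)[A def_A] := gA.
have cardA : #|A| = t.
  apply/eqP; rewrite -(eqn_pmul2l m_gt0) -(card_unrolled m t_gt0 A) -def_A.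
  by rewrite card_openers.
have sub_unrolled (T : {set vertex t}) :
    (unrolled m t_gt0 T \subset openers (mate M) x) = (T \subset A).
  rewrite def_A; apply/subsetP/subsetP => [sub v Tv|sub v].
    by have := sub (unroll (Ordinal m_gt0, v)); rewrite !inE !reduce_unroll; apply.
  by rewrite !inE; apply: sub.
rewrite (card_fixed_sets m_gt0 (t_gt0 := t_gt0)
  (P' := fun T => (T \subset A) && (m * #|T| == r))); last first.
  by move=> T; rewrite sub_unrolled card_unrolled.
rewrite (card_fixed_sets m_gt0 (t_gt0 := t_gt0)
  (P' := fun T => (T \subset A) && ((m * #|T|).+1 == r))); last first.
  by move=> T; rewrite sub_unrolled card_unrolled.
rewrite count_scaled_subsets //; congr (_ + _); case: r => [|r].
  by apply: eq_card0 => T; rewrite inE andbF.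
by rewrite mul1n -(count_scaled_subsets _ cardA).
Qed.

Lemma card_fixed_marked k r :
  (forall M, M \in NCM n -> ('P^*^*)%act M g = M ->
     exists2 O, O \in openers_set (mate M) & g @: O = O) ->
  #|[set y in [set y in NCMr n r | even_edges y.1 == k] | marked_act y g == y]|
  = #|fixed_NCM g k| *
      ((m %| r) * 'C(t, r %/ m) + (0 < r) * ((m %| r.-1) * 'C(t, r.-1 %/ m))).
Proof.
move=> fixed_region; rewrite -sum1_card (partition_big fst (mem (fixed_NCM g k))) /=.
  rewrite -sum_nat_const; apply: eq_bigr => M.
  rewrite in_set => /and3P[M_in /eqP gM even_k].
  have [_ /imsetP[x _ ->] gA] := fixed_region M M_in gM.
  rewrite -(count_fixed_marks r M_in gM gA).
  rewrite -(card_imset _ (can_inj (fun S : {set {set vertex n}} => erefl : (M, S).2 = S))).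
  rewrite -sum1_card; apply: eq_bigl => -[M' S]; rewrite in_set.
  apply/andP/imsetP => [[/andP[/setIdP[]]]|[S']].
    rewrite in_set => /and3P[/= _ subS cardS] _ /eqP[gM' gS] /eqP eqM.
    by exists S; rewrite ?eqM // in_set -eqM subS cardS gS eqxx.
  rewrite in_set => /and3P[subS cardS /eqP gS] [-> ->]; split; last exact: eqxx.
  apply/andP; split; last by rewrite /marked_act /= gM gS.
  apply/setIdP; split; last exact: even_k.
  by rewrite in_set; apply/and3P.
move=> [M S]; rewrite in_set => /andP[/setIdP[]].
rewrite in_set => /and3P[/= M_in _ _] even_k /eqP eq_act.
have /= gM := congr1 fst eq_act; apply/setIdP; split=> //=.
by apply/andP; split; [apply/eqP | exact: even_k].
Qed.

Lemma order_rotn_prime p : prime p -> p %| m -> (p.-group <[(rotn n ^+ (t * (m %/ p)))]>)%g.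
Proof.
move=> p_pr p_dvd; have defn : n = (t * (m %/ p)) * p by rewrite -mulnA divnK // mulnC.
rewrite /pgroup -/(order _) orderXdiv order_rotn //; last by rewrite [X in _ %| X]defn dvdn_mulr.
rewrite {1}defn mulKn ?pnat_id //.
by move: n_gt0; rewrite defn muln_gt0 => /andP[].
Qed.

Lemma act_expg M j : ('P^*^*)%act M g = M -> ('P^*^*)%act M (g ^+ j)%g = M.
Proof.
move=> gM; elim: j => [|j IHj]; first by rewrite expg0 act1.
by rewrite expgSr actM IHj.
Qed.

(** A power of g has prime order, so it fixes exactly one region.  As g commutes
    with it, g fixes this region too. *)
Lemma fixed_region_exists M : 1 < m -> M \in NCM n -> ('P^*^*)%act M g = M ->
  exists2 O, O \in openers_set (mate M) & g @: O = O.
Proof.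
move=> m_gt1 M_in gM; set p := pdiv m.
have p_pr : prime p by exact: pdiv_prime.
have p_dvd : p %| m by exact: pdiv_dvd.
set j := m %/ p; have rot_gj := expg_rotation j rot_g.
have gjE : (g ^+ j = rotn n ^+ (t * j))%g by rewrite -expgM.
have pG : (p.-group <[g ^+ j]>)%g by rewrite gjE; apply: order_rotn_prime.
have gjM := act_expg j gM.
have [O OM gjO] := fixed_ops_prime n_gt0 rot_gj p_pr pG (dvdn_mulr t p_dvd) M_in gjM.
exists O => //; have gOM := ops_rotate rot_g M_in gM OM.
apply: (fixed_ops_uniq rot_gj _ M_in gjM gOM OM _ gjO).
  move=> v; rewrite gjE; apply: rotn_free; rewrite mulnC dvdn_pmul2l //.
  rewrite /j -{1}(divnK p_dvd) -[X in _ %| X]muln1 dvdn_pmul2l ?divn_gt0 ?prime_gt0 //; last exact: dvdn_leq.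
  by rewrite dvdn1; case: eqP p_pr => // ->.
rewrite -{2}gjO -!imset_comp; apply: eq_imset => v /=.
by rewrite -!permM -expgS -expgSr.
Qed.

(** By uniqueness of the fixed region, fixed matchings are counted by fixed
    balanced sets, that is by balanced sets on 2t vertices, whose number is
    known for each colour. *)
Lemma count_fixed_NCM k : 1 < m ->
  #|fixed_NCM g k| = (m %| k) * ('C(t, k %/ m) * 'C(t.-1, k %/ m))
     + (m %| k.+1) * ('C(t, k.+1 %/ m) * 'C(t.-1, (k.+1 %/ m).-1)).
Proof.
move=> m_gt1.
pose P n' c (O : {set vertex n'}) := if colour O then c * nodd O == k else c * nodd O == k.+1.
have -> : #|fixed_NCM g k| =
    #|[set O : {set vertex n} | (#|O| == n) && ((g @: O == O) && P n 1 O)]|.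
  rewrite card_by_matching // -sum1_card.
  rewrite (eq_bigl (fun M => (M \in NCM n)
      && ((('P^*^*)%act M g == M) && (even_edges M == k)))); last by move=> M; rewrite [LHS]in_set.
  rewrite big_mkcondr; apply: eq_bigr => M M_in; have [ncs def_M] := NCM_ncmap M_in.
  case: ifP => [/andP[/eqP gM /eqP even_k]|not_fixed].
    have [O OM gO] := fixed_region_exists m_gt1 M_in gM.
    apply/esym/eqP/cards1P; exists O; apply/setP=> O'; rewrite in_set1 in_set.
    apply/and3P/eqP => [[OM' /eqP gO' _]|->]; last first.
      split; [exact: OM | exact/eqP |].
      rewrite /P !mul1n; have := nodd_ops M_in OM.
      by rewrite even_k; case: (colour O); [rewrite addn1 => -[->] | rewrite addn0 => ->].
    have g_free v : g v != v by apply: rotn_free; rewrite gtnNdvd // ltn_Pmull.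
    exact: (fixed_ops_uniq rot_g g_free M_in gM OM' OM).
  apply/esym/eq_card0 => O; rewrite in_set; apply/negP=> /and3P[OM /eqP gO PO].
  have gM := ops_fixed rot_g M_in OM gO.
  move: not_fixed PO; rewrite gM eqxx /P !mul1n; have := nodd_ops M_in OM.
  case: (colour O); first by rewrite addn1 => -[->] /= ->.
  by rewrite addn0 => -> /=; rewrite eqSS => ->.
have -> : [set O : {set vertex n} | (#|O| == n) && ((g @: O == O) && P n 1 O)]
   = [set O : {set vertex n} | (g @: O == O) && ((#|O| == n) && P n 1 O)].
  by apply/setP=> O; rewrite !in_set andbCA.
rewrite (card_fixed_sets m_gt0 (t_gt0 := t_gt0)
  (P' := fun O => (#|O| == t) && P t m O)); last first.
  move=> O; rewrite card_unrolled eqn_pmul2l //; case: eqP => //= cardO.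
  by rewrite /P colour_unrolled // nodd_unrolled !mul1n.
rewrite -(cardsID [set O : {set vertex t} | colour O]); congr (_ + _).
  case dvd_k: (m %| k); last first.
    apply: eq_card0 => O; rewrite in_setI !in_set /P; apply/negP=> /andP[/andP[_ PO] col_O].
    by move: PO; rewrite col_O => /eqP def_k; rewrite -def_k dvdn_mulr in dvd_k.
  rewrite mul1n -(proj1 (narayana_count t_gt0 _)) -count_coloured //.
  congr #|pred_of_set _|; apply/setP=> O; rewrite in_setI !in_set /P -andbA.
  congr (_ && _); rewrite andbC; case: (colour O) => //=.
  by rewrite -[RHS](eqn_pmul2l m_gt0) [m * (_ %/ _)]mulnC divnK.
case dvd_k: (m %| k.+1); last first.
  apply: eq_card0 => O; rewrite in_setD !in_set /P; apply/negP=> /and3P[col_O _ PO].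
  by move: PO; rewrite (negPf col_O) => /eqP def_k; rewrite -def_k dvdn_mulr in dvd_k.
have [a def_a] : exists a, k.+1 %/ m = a.+1.
  by exists (k.+1 %/ m).-1; rewrite prednK // divn_gt0 // dvdn_leq.
rewrite mul1n def_a -(proj2 (narayana_count t_gt0 _)) -count_uncoloured //.
congr #|pred_of_set _|; apply/setP=> O; rewrite in_setD !in_set /P.
rewrite andbCA; congr (_ && _); case: (colour O) => //=.
by rewrite -[RHS](eqn_pmul2l m_gt0) -def_a [m * (_ %/ _)]mulnC divnK.
Qed.

End Divisor.

Import GRing.Theory Num.Theory.

Local Notation ev p z := ((map_poly (intr : int -> algC) p).[z])%R.

(** * Cyclic sieving *)

Lemma ev_qnar1 n k : 0 < n -> ev (qnar n k) 1%R = (narayana n k)%:R%R.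
Proof.
move=> n_gt0; rewrite /qnar rmorphM hornerM /= map_polyXn hornerXn expr1n mul1r.
have := congr1 (fun p => ev p 1%R) (qlogc0_absorb n.-1 k).
rewrite (prednK n_gt0) !rmorphM !hornerM /= ev_qint1 !ev_qbin1 -natrM.
rewrite -(proj1 (narayana_count n_gt0 k)) natrM.
by apply: mulfI; rewrite pnatr_eq0.
Qed.

(** Integer powers of the rotation and of the root of unity are natural powers
    with the same exponent. *)
Lemma expgz_pow n d : 0 < n ->
  exists i, expgz (rotn n) d = (rotn n ^+ i)%g /\
    forall xi : algC, (n.-primitive_root xi -> xi ^ d = xi ^+ i)%R.
Proof.
move=> n_gt0; case: d => [i|j]; first by exists i.
have sum_n : n.-1 * j.+1 + j.+1 = n * j.+1.
  by rewrite -{2}(prednK n_gt0) mulSn addnC.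
exists (n.-1 * j.+1); split => [|xi xi_prim].
  rewrite /expgz; apply/eqP; rewrite eq_invg_mul -expgD addnC sum_n expgM.
  have rotn_n : (rotn n ^+ n)%g = 1%g.
    by have := expg_order (rotn n); rewrite (order_rotn n_gt0).
  by rewrite rotn_n expg1n.
rewrite NegzE -exprnN; apply: (mulIf (x := (xi ^+ j.+1)%R)).
  by rewrite expf_neq0 // (prim_root_eq0 xi_prim) -lt0n.
rewrite -exprD sum_n exprM (prim_expr_order xi_prim) expr1n mulVf //.
by rewrite expf_neq0 // (prim_root_eq0 xi_prim) -lt0n.
Qed.

Theorem theorem62 (n k r : nat) (k_ge1 : 1 <= k) (k_le_n : k <= n)
    (r_le : r <= n.+1) :
  exists f : {poly int},
    FracField.tofrac f = (qNarayana n k.+1 * qbinom n.+1 r)%R /\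
    cyclic_sieving (marked_action n)
      [set x in NCMr n r | even_edges x.1 == k]
      <[rotn n]>%G (rotn n) n f.
Proof.
have n_gt0 : 0 < n by exact: leq_trans k_ge1 k_le_n.
exists (qnar n k * qbin n.+1 r)%R; split.
  by rewrite qNarayanaE // qbinomE -rmorphM.
set X := [set x in _ | _]; split.
- by split=> //; exact: order_rotn.
- rewrite /acts_on cycle_subG !inE; apply/subsetP=> x Xx; rewrite inE /=.
  exact: (marked_act_NCMr n_gt0 (rotn_rotation n) Xx).
- by apply: nneg_coefsM; [apply: qnar_nneg | apply: qbin_nneg].
move=> xi xi_prim d; have [i [-> /(_ xi xi_prim) ->]] := expgz_pow d n_gt0.
(* The powers of exponents i and t of the rotation generate the same group, so
   the order m of the root of unity and t are such that n = m t. *)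
set t := gcdn i n; have t_gt0 : 0 < t by rewrite gcdn_gt0 n_gt0 orbT.
have t_dvd : t %| n by exact: dvdn_gcdr.
have cyc_eq : (<[rotn n ^+ i]> = <[rotn n ^+ t]>)%g.
  apply/eqP; rewrite (eq_subG_cyclic (cycle_cyclic (rotn n))) ?cycle_subG ?mem_cycle //.
  by rewrite -!/(order _) !orderXgcd order_rotn // [gcdn n i]gcdnC -/t (gcdn_idPr t_dvd).
rewrite /= -afix_cycle cyc_eq afix_cycle.
have z_prim := exp_prim_root xi_prim i; rewrite -/t in z_prim.
move: (xi ^+ i)%R z_prim => z; move: t t_gt0 t_dvd {cyc_eq} => t t_gt0.
case/dvdnP=> m def_n; subst n; rewrite mulnK // => z_prim.
have m_gt0 : 0 < m by move: n_gt0; rewrite muln_gt0 => /andP[].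
rewrite rmorphM hornerM /=.
have -> : #|'Fix_(X | marked_action (m * t))[rotn (m * t) ^+ t]|%g
    = #|[set y in X | marked_act y (rotn (m * t) ^+ t)%g == y]|.
  by congr #|pred_of_set _|; apply/setP=> y; rewrite in_setI in_set; congr (_ && _);
    apply/afix1P/eqP.
case: (ltngtP m 1) => [|m_gt1|m1]; first by rewrite ltnNge m_gt0.
  rewrite card_fixed_marked //; last by move=> M; exact: fixed_region_exists.
  by rewrite count_fixed_NCM // ev_qnar // ev_qbin_succ // natrM.
(* The rotation of order 1 fixes every region, so uniqueness of the fixed region
   fails; but every matching is fixed, and [narayana_count] applies directly. *)
subst m; have z1 : z = 1%R by rewrite -[z]expr1; exact: prim_expr_order z_prim.
have g1 : (rotn (1 * t) ^+ t = 1)%g.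
  by rewrite [X in (_ ^+ X)%g](esym (mul1n t)) -[RHS](expg_order (rotn (1 * t))) (order_rotn n_gt0).
have act1M (M : {set {set vertex (1 * t)}}) : ('P^*^*)%act M (rotn (1 * t) ^+ t)%g = M.
  by rewrite g1 act1.
rewrite card_fixed_marked //; last first.
  move=> M M_in _; have v0 : vertex (1 * t) by apply: (@Ordinal _ 0); rewrite double_gt0.
  exists (openers (mate M) v0); first exact: imset_f.
  by rewrite g1 -[RHS]imset_id; apply: eq_imset => v; rewrite perm1.
have -> : #|fixed_NCM (rotn (1 * t) ^+ t)%g k| = narayana (1 * t) k.
  congr #|pred_of_set _|; apply/setP=> M; apply/setIdP/setIdP => -[M_in].
    by case/andP.
  by move=> even_k; split=> //; apply/andP; split; first exact/eqP/act1M.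
rewrite z1 ev_qnar1 // ev_qbin1 -natrM; congr (_ * _)%:R%R.
rewrite !dvd1n !divn1 !mul1n; case: r {r_le X} => [|r]; first by rewrite !bin0.
by rewrite mul1n binS.
Qed.
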